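(* Let $n$ be a non-negative (time-global) entropy solution of $$\partial_t n+\partial_x F(x,n)=0,\quad F(x,n)=(2x-x^2)n-n^2,\qquad x>0,\ t>0,\qquad F(x,n)\to 0 \text{ as } x\to\infty,$$ with compactly supported initial data $n_0\in L^1([0,\infty))$. For $\beta\in[0,2]$ let $\hat n_\beta(x)=2x-x^2$ for $x\in(\beta,2)$ and $\hat n_\beta(x)=0$ for $x\notin(\beta,2)$. Let $\alpha\in[0,2]$ be such that $$\lim_{t\to\infty}\int_0^\infty|n(t,x)-\hat n_\alpha(x)|\,dx=0.$$ Then $$N[\hat n_\alpha]\ \ge\ \sup_{t\ge0}\int_0^2\min\big(n(t,x),\hat n_0(x)\big)\,dx,$$ where $N[f]=\int_0^\infty f(x)\,dx$. Further, if $n_0$ is not identically $0$, then neither is $\hat n_\alpha$.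
   Context: Let $F(x,n)=(2x-x^2)n-n^2$ and write $F_x(x,k)=(2-2x)k$ for its partial derivative in $x$; $\operatorname{sign}(0)=0$. Note that $\hat n_0$ (with a hat) is the function $\hat n_\beta$ with $\beta=0$, i.e. $(2x-x^2)_+$, whereas $n_0$ is the initial data. Entropy solution. A function $n(t,x)$ is an entropy solution of $\partial_t n+\partial_xF(x,n)=0$ on $x>0$, $t\in(0,T)$, with boundary condition $F(x,n)\to0$ as $x\to\infty$, if: (i) $n\in L^1([0,T]\times[0,\infty))\cap L^1([0,T];L^2([0,\infty)))$ and for every $\phi\in C_c^\infty((0,T)\times(0,\infty))$, $\int_0^T\int_0^\infty \big(n\,\partial_t\phi+F(x,n)\,\partial_x\phi\big)\,dx\,dt=0$; (ii) for every $k\in\mathbb{R}$ and every non-negative $\phi\in C_c^\infty((0,T)\times(0,\infty))$, $$\int_0^T\int_0^\infty\Big[|n-k|\,\partial_t\phi+\operatorname{sign}(n-k)\big(F(x,n)-F(x,k)\big)\partial_x\phi-\operatorname{sign}(n-k)F_x(x,k)\,\phi\Big]dx\,dt\ge0;$$ (iii) $\lim_{R\to\infty}\int_0^T|F(R,n(t,R))|\,dt=0$. It is time-global if this holds for every $T>0$. No boundary condition is imposed at $x=0$. Initial data $n_0$ means: $n\in C([0,T];L^1((0,\infty)))$ (after modification on a null set of times) with $n(0,\cdot)=n_0$. Statements ''identically $0$'' are a.e. in $x$. The value $n(t,R)$ for $R>0$ is understood as a trace from $x<R$. *)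

(* Defs.v *)
From HB Require Import structures.
From mathcomp Require Import all_boot all_order all_algebra.
From mathcomp Require Import all_classical all_reals all_analysis.

Set Implicit Arguments.
Unset Strict Implicit.
Unset Printing Implicit Defensive.

Import Order.TTheory GRing.Theory Num.Theory.
Import numFieldNormedType.Exports.

Local Open Scope classical_set_scope.
Local Open Scope ring_scope.

Notation leb R := (@lebesgue_measure R).

Notation leb2 R := (leb R \x leb R)%E.

Definition flux (R : realType) (x k : R) : R := (2 * x - x ^+ 2) * k - k ^+ 2.

Definition flux_x (R : realType) (x k : R) : R := (2 - 2 * x) * k.

(* Functions of time and space are curried, time first. *)
Definition pdt (R : realType) (phi : R -> R -> R) : R -> R -> R :=
  fun t x => derive1 (phi ^~ x) t.

Definition pdx (R : realType) (phi : R -> R -> R) : R -> R -> R :=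
  fun t x => derive1 (phi t) x.

Fixpoint Ck (R : realType) (k : nat) (phi : R -> R -> R) : Prop :=
  match k with
  | 0%N => continuous (fun p : R * R => phi p.1 p.2)
  | k'.+1 => [/\ forall t x, derivable (phi ^~ x) t 1,
                 forall t x, derivable (phi t) x 1,
                 Ck k' (pdt phi) & Ck k' (pdx phi)]
  end.

(* C_c^\infty((0,T) x (0,\infty)), each function being extended by 0 to the
   whole plane. *)
Definition test_function (R : realType) (T : R) (phi : R -> R -> R) : Prop :=
  (forall k, Ck k phi) /\
  exists K : set (R * R),
    [/\ compact K, K `<=` `]0, T[ `*` `]0, +oo[ &
        forall t x, ~ K (t, x) -> phi t x = 0].

(* n \in L^1([0,T]; L^2([0,\infty))); measurability comes with integrability
   on the product in [entropy_solution_on]. *)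
Definition in_L1L2 (R : realType) (T : R) (n : R -> R -> R) : Prop :=
  (\int[leb R]_(t in `[0%R, T])
     (\int[leb R]_(x in `[0%R, +oo[) ((n t x) ^+ 2)%:E) `^ (2^-1) < +oo)%E.

(* g is the strong trace of n on the line x = r from the side x < r: the slices
   n(., x) converge to g in L^1_loc(0,T) as x increases to r, outside a null set
   of x. *)
Definition left_trace (R : realType) (T : R) (n : R -> R -> R) (r : R)
    (g : R -> R) : Prop :=
  measurable_fun `]0, T[ g /\
  forall a b, 0 < a -> a < b -> b < T -> forall e, 0 < e ->
    exists2 d, 0 < d &
      {ae leb R, forall x, x \in `]r - d, r[ ->
        (\int[leb R]_(t in `[a, b]) `|n t x - g t|%:E <= e%:E)%E}.

(* The integrals below are extended-real valued, with +oo - +oo = -oo; so the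
   equation [entropy_weak] includes the absolute convergence of its integral,
   although L^1([0,T]; L^2) alone does not make n^2 locally integrable. Absolute
   convergence in [entropy_ineq] follows from that in [entropy_weak]. *)
Record entropy_solution_on (R : realType) (T : R) (n : R -> R -> R) : Prop :=
  EntropySolutionOn {
  entropy_L1 : (leb2 R).-integrable (`[0, T] `*` `[0, +oo[)
                 (fun p : R * R => (n p.1 p.2)%:E) ;
  entropy_L1L2 : in_L1L2 T n ;
  entropy_weak : forall phi, test_function T phi ->
    (\int[leb2 R]_(p in `]0%R, T[ `*` `]0%R, +oo[)
       (n p.1 p.2 * pdt phi p.1 p.2
        + flux p.2 (n p.1 p.2) * pdx phi p.1 p.2)%:E = 0)%E ;
  entropy_ineq : forall (k : R) phi, test_function T phi ->
    (forall t x, 0 <= phi t x) ->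
    (0 <= \int[leb2 R]_(p in `]0%R, T[ `*` `]0%R, +oo[)
       (`|n p.1 p.2 - k| * pdt phi p.1 p.2
        + Num.sg (n p.1 p.2 - k) * (flux p.2 (n p.1 p.2) - flux p.2 k)
          * pdx phi p.1 p.2
        - Num.sg (n p.1 p.2 - k) * flux_x p.2 k * phi p.1 p.2)%:E)%E ;
  entropy_infty : exists2 g : R -> R -> R,
    forall r, 0 < r -> left_trace T n r (g r) &
    (\int[leb R]_(t in `]0%R, T[) `|flux r (g r t)|%:E)%E @[r --> +oo] --> 0%E
}.

Definition entropy_solution (R : realType) (n : R -> R -> R) : Prop :=
  forall T, 0 < T -> entropy_solution_on T n.

(* n is the representative that is continuous in time with values in
   L^1((0,\infty)), and n0 is its value at time 0. *)
Definition initial_data (R : realType) (n : R -> R -> R) (n0 : R -> R) : Prop :=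
  [/\ forall t, 0 <= t ->
        (leb R).-integrable `]0, +oo[ (fun x => (n t x)%:E),
      forall T, 0 < T -> forall t, t \in `[0, T] ->
        (\int[leb R]_(x in `]0%R, +oo[) `|n s x - n t x|%:E)%E
          @[s --> within `[0, T] (nbhs t)] --> 0%E &
      {ae leb R, forall x, 0 < x -> n 0 x = n0 x}].

Definition compactly_supported (R : realType) (f : R -> R) : Prop :=
  exists A : R, {ae leb R, forall x, A < x -> f x = 0}.

Definition ae_zero (R : realType) (f : R -> R) : Prop :=
  {ae leb R, forall x, 0 <= x -> f x = 0}.

Definition nhat (R : realType) (beta x : R) : R :=
  if beta < x < 2 then 2 * x - x ^+ 2 else 0.

Definition total_number (R : realType) (f : R -> R) : \bar R :=
  (\int[leb R]_(x in `[0%R, +oo[) (f x)%:E)%E.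

(* Main.v *)
Require Import Defs.
From HB Require Import structures.
From mathcomp Require Import all_boot all_order all_algebra.
From mathcomp Require Import all_classical all_reals all_analysis.
From mathcomp Require Import measurable_realfun ring lra.
Import Order.TTheory GRing.Theory Num.Theory.
Import numFieldNormedType.Exports.

Set Implicit Arguments.
Unset Strict Implicit.

Local Open Scope classical_set_scope.
Local Open Scope ring_scope.

(** Write V(x) = 2x - x^2, so that F(x, n) = n (V - n) and V is a steady state
    with zero flux.  Kruzhkov's inequality is assumed for constants k only.  To
    reach the profile V, use the constant k with the test function
    theta(t) psi(x) rho(k - V(x)), where rho is a mollifier of width e, and sum
    over a fine grid of values of k.  After an integration by parts in k the
    term with rho' cancels the source term up to O(e), because
    d/dx F(x, V(x)) = 0.  No variable of n is doubled, so no Lebesgue points of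
    n are needed.

    Subtracting the resulting inequality for |n - V| from the equation shows
    that the integral of min(n, V) psi decreases at most by what crosses the
    right end of the support of psi; there F(x, min(n, V)) is at most V^2 / 4,
    which vanishes at x = 2, and at the left end the flux enters.  Hence the
    integral of min(n, V) over (0, 2) is nondecreasing in time.

    If its limit is 0, then n vanishes on (0, 2) at all times.  Beyond x = 2
    the flux is nonpositive, so no mass leaves a window (1, r) at its right
    end, and the mass in it is nondecreasing; it tends to 0, so n0 = 0. *)

(** * Smooth functions of one variable *)

Section smooth.
Context {R : realType}.
Implicit Types (f g : R -> R) (k : nat) (x d : R).

(** The entropy flux is quadratic in n, so all estimates rest on the integrability of 1 + n^2 on
    compact rectangles. Every error made in passing from constants to V is bounded by e times a
    multiple of 1 + n^2, uniformly in the point (t, x), and so disappears after integration as e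
    tends to 0.

    The values of k are summed rather than integrated: for given e the grid is finite and fixed, so
    adding the inequalities needs no measurability in k and no further exchange of integrals. The
    price is the jump of sg(n - k) in k; only the grid step that contains n sees it, and its
    contribution is written as a difference that telescopes.

    The cut-off near x = 2 has slope of order 1 / delta on a strip where V is at most 2 delta. The
    flux there is of order delta^2, so the loss is of order delta times the length of the time span.
    Hence the late time, at which n is close to its limit, is fixed first and delta afterwards.

    All mollifiers and cut-offs are rescalings of a single smooth step. *)

Fixpoint ndiff (k : nat) (f : R -> R) : Prop :=
  match k with
  | 0%N => continuous f
  | k'.+1 => (forall x, derivable f x 1) /\ ndiff k' (derive1 f)
  end.

Definition smooth f : Prop := forall k, ndiff k f.

Lemma is_derive1P f x : derivable f x 1 -> is_derive x 1 f (derive1 f x).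
Proof. by move=> df; rewrite derive1E; exact: derivableP. Qed.

Lemma derive1_val f x d : is_derive x 1 f d -> derive1 f x = d.
Proof. by move=> df; rewrite derive1E; exact: derive_val. Qed.

Lemma derive1_ext f g : (forall x, is_derive x 1 f (g x)) -> derive1 f = g.
Proof. by move=> df; apply/funext => x; exact: derive1_val. Qed.

Lemma derivable_continuous f : (forall x, derivable f x 1) -> continuous f.
Proof. by move=> df x; exact/differentiable_continuous/derivable1_diffP. Qed.

Lemma ndiffS k f : ndiff k.+1 f -> ndiff k f.
Proof.
elim: k f => [|k IH] f; first by case=> df _; exact: derivable_continuous.
by case=> df d2f; split=> //; exact: IH.
Qed.

Lemma ndiff_step k f g : (forall x, is_derive x 1 f (g x)) -> ndiff k g ->
  ndiff k.+1 f.
Proof.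
move=> fg kg; split; first by move=> x; have [] := fg x.
by rewrite (derive1_ext fg).
Qed.

Lemma smooth_derivable f x : smooth f -> derivable f x 1.
Proof. by move=> /(_ 1%N)[]. Qed.

Lemma smooth_is_derive f x : smooth f -> is_derive x 1 f (derive1 f x).
Proof. by move=> sf; exact/is_derive1P/smooth_derivable. Qed.

Lemma smooth_derive1 f : smooth f -> smooth (derive1 f).
Proof. by move=> sf k; case: (sf k.+1). Qed.

Lemma smooth_continuous f : smooth f -> continuous f.
Proof. exact: (fun sf => sf 0%N). Qed.

Lemma ndiff_cst k (c : R) : ndiff k (fun=> c).
Proof.
elim: k c => [|k IH] c; first by move=> x; exact: cvg_cst.
by apply: ndiff_step (IH 0) => x; exact: is_derive_cst.
Qed.

Lemma ndiffD k f g : ndiff k f -> ndiff k g -> ndiff k (fun x => f x + g x).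
Proof.
elim: k f g => [|k IH] f g; first by move=> cf cg x; exact: (continuousD (cf x) (cg x)).
move=> [df kf] [dg kg]; apply: ndiff_step (IH _ _ kf kg) => x.
by apply: is_deriveD; exact: is_derive1P.
Qed.

Lemma ndiffM k f g : ndiff k f -> ndiff k g -> ndiff k (fun x => f x * g x).
Proof.
elim: k f g => [|k IH] f g; first by move=> cf cg x; exact: (continuousM (cf x) (cg x)).
move=> kf kg; have [df k'f] := kf; have [dg k'g] := kg.
apply: (@ndiff_step _ _ (fun x => f x * derive1 g x + g x * derive1 f x)).
  by move=> x; apply: is_deriveM; exact: is_derive1P.
by apply: ndiffD; apply: IH => //; exact: ndiffS.
Qed.

Lemma smooth_cst (c : R) : smooth (fun=> c).
Proof. by move=> k; exact: ndiff_cst. Qed.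

Lemma smoothD f g : smooth f -> smooth g -> smooth (fun x => f x + g x).
Proof. by move=> sf sg k; exact: ndiffD. Qed.

Lemma smoothM f g : smooth f -> smooth g -> smooth (fun x => f x * g x).
Proof. by move=> sf sg k; exact: ndiffM. Qed.

Lemma smoothN f : smooth f -> smooth (fun x => - f x).
Proof.
move=> sf; rewrite (_ : (fun x => _) = fun x => -1 * f x).
  by apply: smoothM => //; exact: smooth_cst.
by apply/funext => x; rewrite mulN1r.
Qed.

Lemma smoothB f g : smooth f -> smooth g -> smooth (fun x => f x - g x).
Proof. by move=> sf sg; apply: smoothD => //; exact: smoothN. Qed.

Lemma smooth_id : smooth (fun x : R => x).
Proof.
case=> [|k]; first by move=> x; exact: cvg_id.
by apply: ndiff_step (ndiff_cst k 1) => x; exact: is_derive_id.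
Qed.

Lemma ndiff_comp k f g : ndiff k f -> ndiff k g -> ndiff k (fun x => f (g x)).
Proof.
elim: k f g => [|k IH] f g.
  by move=> cf cg x; exact: (@continuous_comp _ _ _ g f x (cg x) (cf _)).
move=> kf kg; have [df k'f] := kf; have [dg k'g] := kg.
apply: (@ndiff_step _ _ (fun x => derive1 f (g x) * derive1 g x)).
  by move=> x; apply: is_derive1_comp; exact: is_derive1P.
by apply: ndiffM => //; apply: IH => //; exact: ndiffS.
Qed.

Lemma smooth_comp f g : smooth f -> smooth g -> smooth (fun x => f (g x)).
Proof. by move=> sf sg k; exact: ndiff_comp. Qed.

(** The derivative -f' (1/f)^2 involves 1/f again, but with one order of differentiability less to
    prove, so the induction is on the order for 1/f itself. *)
Lemma smoothV f : (forall x, f x != 0) -> smooth f -> smooth (fun x => (f x)^-1).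
Proof.
move=> f0 sf; have df x : is_derive x 1 (fun x => (f x)^-1)
    (- derive1 f x * ((f x)^-1 * (f x)^-1)).
  have := @is_deriveV _ f x (derive1 f x) 1 (f0 x) (smooth_is_derive x sf).
  move=> H; apply: (is_derive_eq H); rewrite /GRing.scale/= -exprVn expr2; lra.
elim=> [|k IH].
  by move=> x; apply: cvgV => //; exact: smooth_continuous.
apply: ndiff_step df _; apply: ndiffM; last exact: ndiffM.
by apply: smoothN; exact: smooth_derive1.
Qed.

End smooth.

(** * The flat function exp(-1/x) and a smooth step *)

Section flat.
Context {R : realType}.

(* x^-k exp(-1/x), extended by zero: the family is closed under d/dx, and
   exp(-1/x) itself is the case k = 0. *)
Definition flat (k : nat) (x : R) : R :=
  if 0 < x then x^-1 ^+ k * expR (- x^-1) else 0.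

(** With y = 1/x, the exponential series gives exp(y) >= y^(k+2) / (k+2)!, hence y^k exp(-y) <=
    (k+2)! / y^2. A quadratic bound is what makes the derivative at 0 vanish. *)
Lemma flat_le (k : nat) (x : R) : `|flat k x| <= (k.+2)`!%:R * `|x| ^+ 2.
Proof.
rewrite /flat; case: ifPn => x0; last by rewrite normr0 mulr_ge0// exprn_ge0.
have y0 : 0 < x^-1 by rewrite invr_gt0.
have F0 : 0 < (k.+2)`!%:R :> R by rewrite ltr0n fact_gt0.
rewrite (gtr0_norm x0) ger0_norm ?mulr_ge0 ?expR_ge0 ?exprn_ge0 ?(ltW y0)//.
rewrite expRN ler_pdivrMr ?expR_gt0//.
have /= := expR_ge1Dxn k.+1 (ltW y0).
move=> H.
have {}H : x^-1 ^+ k.+2 / (k.+2)`!%:R <= expR x^-1.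
  by apply: le_trans H; rewrite lerDr.
apply: le_trans (_ : (k.+2)`!%:R * x ^+ 2 * (x^-1 ^+ k.+2 / (k.+2)`!%:R) <= _); last first.
  by apply: ler_wpM2l => //; rewrite mulr_ge0 ?(ltW F0)// exprn_ge0// ltW.
rewrite -addn2 exprD.
have -> : (k + 2)`!%:R * x ^+ 2 * (x^-1 ^+ k * x^-1 ^+ 2 / (k + 2)`!%:R) = x^-1 ^+ k.
  rewrite addn2; field; rewrite (gt_eqF x0)/= ?gt_eqF //.
exact: lexx.
Qed.

(** Away from 0 this is the product rule. At 0 the difference quotient is at most (k+2)! |h| by
    [flat_le]. As the derivative stays in the span of the family, smoothness follows by induction on
    the order, for all k at once. *)
Lemma is_derive_flat (k : nat) (x : R) :
  is_derive x 1 (flat k) (flat k.+2 x - k%:R * flat k.+1 x).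
Proof.
have [x0|x0|->] := ltgtP x 0.
- have e : \near x, cst 0 x = flat k x.
    by apply: filterS (lt_nbhsl x0) => y y0; rewrite /flat ifN// -leNgt ltW.
  apply: near_eq_is_derive e _.
  by rewrite /flat !ifN -?leNgt ?(ltW x0)// mulr0 subrr; exact: is_derive_cst.
- have e : \near x, x^-1 ^+ k * expR (- x^-1) = flat k x.
    by apply: filterS (lt_nbhsr x0) => y y0; rewrite /flat ifT.
  apply: near_eq_is_derive e _.
  have x1 : x != 0 by rewrite gt_eqF.
  have dV : is_derive x 1 (fun y : R => y^-1) (- x ^- 2).
    have := @is_deriveV _ id x 1 1 x1 (is_derive_id _ _).
    by rewrite /GRing.scale/= mulr1.
  have := @is_deriveX _ _ _ k x 1 _ dV; rewrite exprfctE => dX.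
  have dE := @is_derive1_comp _ expR (fun y : R => - y^-1) x _ _
    (is_derive_expR _) (is_deriveN dV).
  have := is_deriveM dX dE.
  rewrite /flat x0 /GRing.scale/= => H. apply: (is_derive_eq H) => {H}.
  case: k {dX} => [|k] /=; rewrite ?exprS; by field.
- have f0 j : flat j 0 = 0 by rewrite /flat ltxx.
  rewrite !f0 mulr0 subrr.
  have H : (h^-1 *: (flat k (h *: 1 + 0) - flat k 0)) @[h --> (0:R)^'] --> (0:R).
    apply/cvgr0Pnorm_le => e e0.
    have F0 : 0 < (k.+2)`!%:R :> R by rewrite ltr0n fact_gt0.
    have d0 : 0 < e / (k.+2)`!%:R by rewrite divr_gt0.
    near=> h; have h0 : h != 0 by near: h; exact: nbhs_dnbhs_neq.
    rewrite f0 subr0 addr0 /GRing.scale/= mulr1 normrM normfV.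
    rewrite ler_pdivrMl ?normr_gt0//.
    apply: le_trans (flat_le k h) _.
    rewrite expr2 mulrCA ler_wpM2l// -ler_pdivlMl// mulrC.
    near: h; apply: dnbhs0_le; exact: d0.
  split; first by apply/cvg_ex; exists 0.
  exact: cvg_lim H.
Unshelve. all: by end_near. Qed.

Lemma ndiff_flat (m k : nat) : ndiff m (flat k).
Proof.
elim: m k => [|m IH] k.
  by apply: derivable_continuous => x; have [] := is_derive_flat k x.
apply: ndiff_step (is_derive_flat k) _.
apply: ndiffD => //; apply: (@ndiff_comp _ m -%R).
  by apply: smoothN; exact: smooth_id.
by apply: ndiffM => //; exact: ndiff_cst.
Qed.

End flat.

Section step.
Context {R : realType}.

(** The witness is f(x) / (f(x) + f(1 - x)) with f = [flat 0]; the denominator is positive because x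
    or 1 - x is. In the quotient rule only f(1 - x) f'(x) + f(x) f'(1 - x) survives in the
    numerator, which is non-negative. Monotonicity matters because the derivative of the step serves
    as a mollifier. *)
Lemma exists_smooth_step : exists S : R -> R,
  [/\ smooth S, forall x, x <= 0 -> S x = 0, forall x, 1 <= x -> S x = 1 &
      forall x, 0 <= derive1 S x].
Proof.
pose f := @flat R 0; pose f1 (x : R) := f (1 - x).
have f0 x : x <= 0 -> f x = 0 by move=> x0; rewrite /f /flat ifN// -leNgt.
have fp x : 0 < x -> 0 < f x.
  by move=> x0; rewrite /f /flat x0 expr0 mul1r expR_gt0.
have fge0 x : 0 <= f x by case: (leP x 0) => [/f0->//|/fp/ltW].
have sf : smooth f by move=> k; exact: ndiff_flat.
have sf1 : smooth f1.
  by apply: smooth_comp => //; apply: smoothB; [exact: smooth_cst|exact: smooth_id].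
have den x : 0 < f x + f1 x.
  have [x0|x0] := ltP 0 x; first by rewrite ltr_wpDr ?fp// /f1.
  by rewrite ltr_wpDl// /f1 fp//; lra.
have dfge0 x : 0 <= derive1 f x.
  rewrite (derive1_val (is_derive_flat 0 x)) mul0r subr0 /flat.
  by case: ifP => // x0; rewrite mulr_ge0 ?expR_ge0// exprn_ge0// invr_ge0 ltW.
exists (fun x => f x * (f x + f1 x)^-1); split.
- apply: smoothM => //; apply: smoothV; first by move=> x; rewrite gt_eqF.
  exact: smoothD.
- by move=> x /f0 ->; rewrite mul0r.
- move=> x x1; rewrite /f1 (f0 (1 - x)) ?subr_le0// addr0 divff// gt_eqF// fp//; lra.
move=> x; have dN : f x + f1 x != 0 by rewrite gt_eqF.
have df := smooth_is_derive x sf.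
have df1 : is_derive x 1 f1 (- derive1 f (1 - x)).
  have H := @is_derive1_comp _ f (fun y => 1 - y) x _ _ (smooth_is_derive (1 - x) sf)
    (is_deriveB (is_derive_cst (1:R) x 1) (is_derive_id x 1)).
  by apply: (is_derive_eq H); rewrite sub0r mulrN1.
have dV := @is_deriveV _ (fun x => f x + f1 x) x _ 1 dN (is_deriveD df df1).
rewrite (@derive1_val _ (fun x => f x * (f x + f1 x)^-1) _ _ (is_deriveM df dV)).
rewrite /GRing.scale/=.
rewrite [X in 0 <= X](_ : _ = (f1 x * derive1 f x + f x * derive1 f (1 - x))
  * (f x + f1 x) ^- 2); last by field.
apply: mulr_ge0; last by rewrite invr_ge0 sqr_ge0.
by apply: addr_ge0; apply: mulr_ge0 => //; exact: fge0.
Qed.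

End step.

(** * Test functions and smooth steps *)

Section calculus.
Context {R : realType}.
Implicit Types f : R -> R.

Lemma segment_bounded f (a b : R) : continuous f ->
  exists2 M, 0 <= M & forall x, a <= x <= b -> `|f x| <= M.
Proof.
move=> cf.
have cf' : {within `[a, b], continuous f} by exact: continuous_subspaceT.
have [M [_ HM]] := compact_bounded (continuous_compact cf' (@segment_compact _ a b)).
exists (`|M| + 1); first by rewrite addr_ge0.
move=> x xab; apply: (HM (`|M| + 1)).
  by rewrite (le_lt_trans (ler_norm _))// ltrDl.
by exists x => //=; rewrite in_itv.
Qed.

Lemma smooth_MVT f (a b : R) : smooth f -> a <= b ->
  exists2 c, a <= c <= b & f b - f a = derive1 f c * (b - a).
Proof.
move=> sf ab.
have [c + ->] := @MVT_segment _ f (derive1 f) a b ab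
  (fun x _ => smooth_is_derive x sf) (continuous_subspaceT (smooth_continuous sf)).
by rewrite in_itv/= => cab; exists c.
Qed.

Lemma smooth_taylor1 f (a b : R) : smooth f ->
  exists2 K, 0 <= K & forall z h, a <= z -> 0 <= h -> z + h <= b ->
    `|f (z + h) - f z - h * derive1 f z| <= K * h ^+ 2.
Proof.
move=> sf; have sf' := smooth_derive1 sf.
have [K K0 HK] := segment_bounded a b (smooth_continuous (smooth_derive1 sf')).
exists K => // z h az h0 zhb.
have zzh : z <= z + h by rewrite lerDl.
have [c czh] := smooth_MVT sf zzh.
have /andP[zc ch] := czh.
have [d dzc] := smooth_MVT sf' zc => E2 E1.
have -> : f (z + h) - f z - h * derive1 f z = h * (derive1 (derive1 f) d * (c - z)).
  by rewrite E1 -E2; ring.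
rewrite 2!normrM (ger0_norm h0) (@ger0_norm _ (c - z)) ?subr_ge0//.
rewrite expr2 [leRHS]mulrCA ler_wpM2l//.
by apply: ler_pM; rewrite ?subr_ge0//; [apply: HK; move/andP: dzc; lra|lra].
Qed.

Lemma derive1_min f (x : R) : smooth f -> (forall y, f x <= f y) -> derive1 f x = 0.
Proof.
move=> sf fx; apply: derive1_val.
apply: (@derive1_at_min _ f (x - 1) (x + 1) x); first lra.
- by move=> t _; exact: smooth_derivable.
- by rewrite in_itv/=; lra.
- by move=> t _.
Qed.

Lemma derive1_max f (x : R) : smooth f -> (forall y, f y <= f x) -> derive1 f x = 0.
Proof.
move=> sf fx; apply: derive1_val.
apply: (@derive1_at_max _ f (x - 1) (x + 1) x); first lra.
- by move=> t _; exact: smooth_derivable.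
- by rewrite in_itv/=; lra.
- by move=> t _.
Qed.

End calculus.

Section product_test_function.
Context {R : realType}.
Implicit Types f g : R -> R.

Lemma derive1Zl f (c x : R) : smooth f ->
  is_derive x 1 (fun y => f y * c) (derive1 f x * c).
Proof.
move=> sf; have := is_deriveM (smooth_is_derive x sf) (is_derive_cst c x 1).
by rewrite /GRing.scale/= mulr0 add0r (mulrC c).
Qed.

Lemma derive1Zr f (c x : R) : smooth f ->
  is_derive x 1 (fun y => c * f y) (c * derive1 f x).
Proof.
move=> sf; have := is_deriveM (is_derive_cst c x 1) (smooth_is_derive x sf).
by rewrite /GRing.scale/= mulr0 addr0.
Qed.

Lemma pdt_prod f g : smooth f ->
  pdt (fun t x => f t * g x) = fun t x => derive1 f t * g x.
Proof.
by move=> sf; apply/funext => t; apply/funext => x; exact/derive1_val/derive1Zl.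
Qed.

Lemma pdx_prod f g : smooth g ->
  pdx (fun t x => f t * g x) = fun t x => f t * derive1 g x.
Proof.
by move=> sg; apply/funext => t; apply/funext => x; exact/derive1_val/derive1Zr.
Qed.

Lemma Ck_prod k f g : smooth f -> smooth g -> Ck k (fun t x => f t * g x).
Proof.
elim: k f g => [|k IH] f g sf sg /=.
  move=> p; apply: (@continuousM _ _ (fun p : R * R => f p.1) (fun p : R * R => g p.2)).
    apply: (@continuous_comp _ _ _ fst f p); first exact: cvg_fst.
    exact: smooth_continuous.
  apply: (@continuous_comp _ _ _ snd g p); first exact: cvg_snd.
  exact: smooth_continuous.
split.
- by move=> t x; have [] := derive1Zl (g x) t sf.
- by move=> t x; have [] := derive1Zr (f t) x sg.
- by rewrite pdt_prod//; apply: IH => //; exact: smooth_derive1.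
- by rewrite pdx_prod//; apply: IH => //; exact: smooth_derive1.
Qed.

Definition supported f (a b : R) := forall x, ~~ (a <= x <= b) -> f x = 0.

Lemma test_function_prod f g (T a b c d : R) : smooth f -> smooth g ->
  0 < a -> b < T -> 0 < c -> supported f a b -> supported g c d ->
  test_function T (fun t x => f t * g x).
Proof.
move=> sf sg a0 bT c0 fab gcd; split; first by move=> k; exact: Ck_prod.
exists (`[a, b] `*` `[c, d]); split.
- by apply: compact_setX; exact: segment_compact.
- move=> [t x]/= []; rewrite !in_itv/= andbT => /andP[? ?] /andP[? ?]; split; lra.
move=> t x /= /not_andP[|] /negP; rewrite in_itv/=.
  by move=> /fab ->; rewrite mul0r.
by move=> /gcd ->; rewrite mulr0.
Qed.

(** A zero of a non-negative function is a minimum, so the derivative vanishes there too. *)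
Lemma supported_derive1 f (a b : R) : smooth f -> (forall x, 0 <= f x) ->
  supported f a b -> supported (derive1 f) a b.
Proof. by move=> sf f0 sab x /sab fx; apply: derive1_min => // y; rewrite fx. Qed.

End product_test_function.

(** The existence of a step is a mere proposition; packing it in a record lets the sections below
    take the step as a parameter, instantiated once in the final theorem. *)
Record smooth_step (R : realType) := SmoothStep {
  step_fun :> R -> R;
  step_smooth : smooth step_fun;
  step_eq0 : forall x, x <= 0 -> step_fun x = 0;
  step_eq1 : forall x, 1 <= x -> step_fun x = 1;
  derive1_step_ge0 : forall x, 0 <= derive1 step_fun x }.

Section step.
Context {R : realType} (S : smooth_step R).

Let sS := step_smooth S.
Let S0 := @step_eq0 _ S.
Let S1 := @step_eq1 _ S.
Let dS := @derive1_step_ge0 _ S.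

Lemma step_le x y : x <= y -> S x <= S y.
Proof.
move=> xy; have [c _ E] := smooth_MVT sS xy.
by rewrite -subr_ge0 E mulr_ge0// subr_ge0.
Qed.

Lemma step_ge0 x : 0 <= S x.
Proof. by have [/S0->//|x0] := leP x 0; rewrite -(S0 (lexx 0)) step_le// ltW. Qed.

Lemma step_le1 x : S x <= 1.
Proof. by have [/S1->//|x1] := leP 1 x; rewrite -(S1 (lexx 1)) step_le// ltW. Qed.

Lemma derive1_step0 x : x <= 0 -> derive1 S x = 0.
Proof. by move=> x0; apply: derive1_min => // y; rewrite S0// step_ge0. Qed.

Lemma derive1_step1 x : 1 <= x -> derive1 S x = 0.
Proof. by move=> x0; apply: derive1_max => // y; rewrite (S1 x0) step_le1. Qed.

(** For e > 0, [stept] climbs from 0 to 1 across [a, a + e], [kern] is its derivative, hence a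
    mollifier of mass one, and [plateau] is 1 on [a + e, b] and 0 outside [a, b + e]. All
    transitions lie to the right of the named point: [plateau S k (2 - k) k] is supported in [k, 2],
    and a kernel attached to a time only looks at later times. *)
Definition stept (a e x : R) : R := S ((x - a) / e).
Definition kern (a e x : R) : R := derive1 S ((x - a) / e) / e.
Definition plateau (a b e x : R) : R := stept a e x - stept b e x.

Lemma smooth_affine (a e : R) : smooth (fun x => (x - a) / e).
Proof.
apply: smoothM; last exact: smooth_cst.
by apply: smoothB; [exact: smooth_id|exact: smooth_cst].
Qed.

Lemma smooth_stept (a e : R) : smooth (stept a e).
Proof. by apply: smooth_comp => //; exact: smooth_affine. Qed.

Lemma smooth_kern (a e : R) : smooth (kern a e).
Proof.
apply: smoothM; last exact: smooth_cst.
by apply: smooth_comp; [exact: smooth_derive1|exact: smooth_affine].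
Qed.

Lemma is_derive_stept (a e x : R) : is_derive x 1 (stept a e) (kern a e x).
Proof.
have da : is_derive x 1 (fun x => (x - a) / e) e^-1.
  have := is_deriveM (is_deriveB (is_derive_id x 1) (is_derive_cst a x 1))
    (is_derive_cst e^-1 x 1).
  by rewrite /GRing.scale/= mulr0 add0r subr0 mulr1.
exact: (is_derive1_comp (smooth_is_derive _ sS) da).
Qed.

Lemma derive1_stept (a e : R) : derive1 (stept a e) = kern a e.
Proof. by apply: derive1_ext => x; exact: is_derive_stept. Qed.

Lemma smooth_plateau (a b e : R) : smooth (plateau a b e).
Proof. by apply: smoothB; exact: smooth_stept. Qed.

Lemma derive1_plateau (a b e : R) :
  derive1 (plateau a b e) = fun x => kern a e x - kern b e x.
Proof.
by apply: derive1_ext => x; apply: is_deriveB; exact: is_derive_stept.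
Qed.

Section positive_width.
Variables (e : R) (e0 : 0 < e).

Lemma kern_ge0 a x : 0 <= kern a e x.
Proof. by rewrite divr_ge0 ?(ltW e0). Qed.

Lemma stept0 a x : x <= a -> stept a e x = 0.
Proof. by move=> xa; rewrite /stept S0// mulr_le0_ge0 ?subr_le0 ?invr_ge0 ?(ltW e0). Qed.

Lemma stept1 a x : a + e <= x -> stept a e x = 1.
Proof. by move=> ax; rewrite /stept S1// ler_pdivlMr// mul1r; lra. Qed.

Lemma kern_supp a x : ~~ (a < x < a + e) -> kern a e x = 0.
Proof.
rewrite negb_and -!leNgt /kern => /orP[xa|ax].
  by rewrite derive1_step0 ?mul0r// mulr_le0_ge0 ?subr_le0 ?invr_ge0 ?(ltW e0).
by rewrite derive1_step1 ?mul0r// ler_pdivlMr// mul1r; lra.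
Qed.

Lemma plateau_ge0 a b x : a <= b -> 0 <= plateau a b e x.
Proof.
by move=> ab; rewrite subr_ge0 step_le// ler_pM2r ?invr_gt0// lerB.
Qed.

Lemma plateau_le1 a b x : plateau a b e x <= 1.
Proof. by rewrite lerBlDr ler_wpDr ?step_ge0// step_le1. Qed.

Lemma plateau1 a b x : a + e <= x <= b -> plateau a b e x = 1.
Proof. by move=> /andP[ax xb]; rewrite /plateau stept1// stept0// subr0. Qed.

Lemma plateau_supp a b : a <= b -> supported (plateau a b e) a (b + e).
Proof.
move=> ab x; rewrite negb_and -!ltNge /plateau => /orP[xa|bx].
  by rewrite !stept0 ?subr0//; lra.
by rewrite !stept1 ?subrr//; lra.
Qed.

End positive_width.
End step.

Arguments stept {R} S a e x.
Arguments kern {R} S a e x.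
Arguments plateau {R} S a b e x.

(** * Riemann sums in the Kruzhkov constant *)

Section riemann.
Context {R : realType}.

(** The function |w - z| is affine in z on each side of w, so its first-order expansion is exact
    unless z <= w < z + h. The right-hand side is 2h times the indicator of that event, written as a
    difference so that it telescopes along a grid. *)
Lemma normr_kink (w z h : R) : 0 <= h ->
  `| `|w - (z + h)| - `|w - z| + h * Num.sg (w - z)| <=
    2 * h * ((z <= w)%R%:R - (z + h <= w)%R%:R).
Proof.
move=> h0; have [zhw|zhw] := leP (z + h) w; have [zw|zw|zw] := ltgtP z w;
  try (exfalso; lra); rewrite /= ?mulr1n ?mulr0n.
- rewrite (@ger0_norm _ (w - (z + h))) ?(@ger0_norm _ (w - z)) ?gtr0_sg; try lra.
  rewrite [X in `|X|](_ : _ = 0) ?normr0; lra.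
- have -> : h = 0 by lra.
  by rewrite addr0 subrr mul0r addr0 normr0 mulr0 mul0r.
- rewrite (@ltr0_norm _ (w - (z + h))) ?(@gtr0_norm _ (w - z)) ?gtr0_sg; try lra.
  rewrite ger0_norm; lra.
- rewrite (@ltr0_norm _ (w - (z + h))) ?(@ltr0_norm _ (w - z)) ?ltr0_sg; try lra.
  rewrite [X in `|X|](_ : _ = 0) ?normr0; lra.
- rewrite zw subrr sgr0 mulr0 normr0 subr0 addr0 normr_id ltr0_norm; lra.
Qed.

Section grid.
Variables (P rho drho : R -> R) (e K : R).
Hypothesis e1 : 0 <= e <= 1.
Hypothesis K0 : 0 <= K.
Hypothesis P0 : forall z : R, z <= 0 -> P z = 0.
Hypothesis P1 : forall z : R, e <= z -> P z = 1.
Hypothesis rho_ge0 : forall z : R, 0 <= rho z.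
Hypothesis rho_supp : forall z : R, ~~ (0 < z < e) -> rho z = 0.
Hypothesis taylorP : forall z h : R, -1 <= z -> 0 <= h -> z + h <= 2 ->
  `|P (z + h) - P z - h * rho z| <= K * h ^+ 2.
Hypothesis taylor_rho : forall z h : R, -1 <= z -> 0 <= h -> z + h <= 2 ->
  `|rho (z + h) - rho z - h * drho z| <= K * h ^+ 2.
Hypothesis rho_le : forall z : R, -1 <= z <= 2 -> rho z <= K.
Hypothesis drho_le : forall z : R, -1 <= z <= 2 -> `|drho z| <= K.

Variables (N : nat) (v w : R).
Hypothesis N0 : (0 < N)%N.
Hypothesis v01 : 0 <= v <= 1.

(** The constants k = j h run through [0, 2]; [z j] is k - V(x) as seen from a point where V(x) = v,
    and w stands for n - V. Since v and e are in [0, 1], the grid of the [z j] reaches from -v <= 0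
    to 2 - v >= e and so covers the support of rho. *)
Let h : R := 2 / N%:R.
Let z (j : nat) : R := j%:R * h - v.

Let e0 : 0 <= e. Proof. by case/andP: e1. Qed.
Let e_le1 : e <= 1. Proof. by case/andP: e1. Qed.
Let v0 : 0 <= v. Proof. by case/andP: v01. Qed.
Let v1 : v <= 1. Proof. by case/andP: v01. Qed.

Let Npos : 0 < N%:R :> R.
Proof. by rewrite ltr0n. Qed.

Let h0 : 0 < h.
Proof. by rewrite divr_gt0. Qed.

Let h2 : h <= 2.
Proof. by rewrite ler_pdivrMr// ler_peMr// ler1n. Qed.

Let Nh : N%:R * h = 2.
Proof. by rewrite /h mulrC divfK// gt_eqF. Qed.

Let zS j : z j.+1 = z j + h.
Proof. by rewrite /z -natr1; ring. Qed.

Let z_rng j : (j < N)%N -> -1 <= z j /\ z j + h <= 2.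
Proof.
move=> jN; rewrite -zS /z; split.
  by have : 0 <= j%:R * h by [rewrite mulr_ge0// ltW]; move: v1; lra.
have : j.+1%:R * h <= 2 by rewrite -Nh ler_wpM2r ?ler_nat// ltW.
move: v0; lra.
Qed.

Let sum_le (a : nat -> R) (c : R) : (forall j, (j < N)%N -> `|a j| <= c) ->
  `|\sum_(0 <= j < N) a j| <= N%:R * c.
Proof.
move=> ac; apply: le_trans (ler_norm_sum _ _ _) _.
apply: (@le_trans _ _ (\sum_(0 <= j < N) c)).
  by rewrite !big_nat; apply: ler_sum => j /andP[_ /ac].
by rewrite sumr_const_nat subn0 mulr_natl.
Qed.

(** The increments of the primitive P telescope to 1; the N Taylor remainders K h^2 add up to 2 K h,
    because N h = 2. *)
Let mass : `|h * \sum_(0 <= j < N) rho (z j) - 1| <= 2 * K * h.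
Proof.
have -> : h * \sum_(0 <= j < N) rho (z j) - 1 =
    - \sum_(0 <= j < N) (P (z j + h) - P (z j) - h * rho (z j)).
  rewrite [in RHS](eq_bigr (fun j => P (z j.+1) - P (z j) - h * rho (z j))); last first.
    by move=> j _; rewrite zS.
  rewrite big_split/= sumrN -mulr_sumr.
  have PN : P (z N) = 1 by apply: P1; rewrite /z Nh; move: e_le1 v1; lra.
  have Pz : P (z 0%N) = 0 by apply: P0; rewrite /z mul0r; move: v0; lra.
  by rewrite (telescope_sumr (fun j => P (z j)))// PN Pz; ring.
rewrite normrN; apply: le_trans (sum_le (c := K * h ^+ 2) _) _.
  by move=> j /z_rng[? ?]; apply: taylorP => //; exact: ltW.
rewrite (_ : N%:R * _ = (N%:R * h) * (K * h)); last ring.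
by rewrite Nh; lra.
Qed.

Let average (q : R -> R) (q0 c : R) : 0 <= c ->
  (forall z, 0 < z < e -> `|q z - q0| <= c) ->
  `|h * \sum_(0 <= j < N) q (z j) * rho (z j) - q0| <=
    c * (1 + 2 * K * h) + `|q0| * (2 * K * h).
Proof.
move=> c0 qc.
have -> : h * \sum_(0 <= j < N) q (z j) * rho (z j) - q0 =
    h * (\sum_(0 <= j < N) (q (z j) - q0) * rho (z j))
    + q0 * (h * \sum_(0 <= j < N) rho (z j) - 1).
  under [in RHS]eq_bigr do rewrite mulrBl.
  by rewrite big_split/= sumrN -mulr_sumr; ring.
apply: le_trans (ler_normD _ _) _; apply: lerD; last first.
  by rewrite normrM ler_wpM2l// mass.
apply: (@le_trans _ _ (c * (h * \sum_(0 <= j < N) rho (z j)))); last first.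
  rewrite ler_wpM2l// -lerBlDl; exact: le_trans (ler_norm _) mass.
rewrite normrM (gtr0_norm h0) mulrCA ler_wpM2l// ?(ltW h0)//.
apply: le_trans (ler_norm_sum _ _ _) _; rewrite mulr_sumr; apply: ler_sum => j _.
rewrite normrM (ger0_norm (rho_ge0 _)).
have [zj|/rho_supp->] := boolP (0 < z j < e); last by rewrite !mulr0.
by rewrite ler_wpM2r// qc.
Qed.

(** A common bound for the three sums below. The part in e is the oscillation over the support of
    rho, the part in h the discretization error; 42 is a convenient integer that also covers the
    worst of the three, the source term. *)
Let err := (2 * e + 42 * K * h) * (1 + `|w|) ^+ 2.

Let W0 : 0 <= `|w|. Proof. exact: normr_ge0. Qed.
Let Kh0 : 0 <= K * h. Proof. by rewrite mulr_ge0// ltW. Qed.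

Lemma grid_abs :
  `|h * \sum_(0 <= j < N) `|w - z j| * rho (z j) - `|w| | <= err.
Proof.
apply: le_trans (average (q := fun z => `|w - z|) (c := e) _ _) _; first exact: e0.
  move=> y /andP[y0 ye]; apply: le_trans (ler_dist_dist _ _) _.
  by rewrite addrAC subrr sub0r normrN ger0_norm; exact: ltW.
have := mulr_ge0 e0 W0; have := mulr_ge0 Kh0 W0.
have e1' : 0 <= 1 - e by rewrite subr_ge0.
have := mulr_ge0 Kh0 e1'; have := mulr_ge0 Kh0 (sqr_ge0 `|w|).
have := mulr_ge0 e0 (sqr_ge0 `|w|).
rewrite normr_id /err; have := e0; have := Kh0; nra.
Qed.

Lemma grid_flux :
  `|h * \sum_(0 <= j < N) (`|w - z j| * (v + w + z j)) * rho (z j)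
    - `|w| * (v + w)| <= err.
Proof.
pose q y := `|w - y| * (v + w + y).
have vw y : 0 <= y -> y <= 1 -> `|v + w + y| <= `|w| + 2.
  move=> y0 y1; apply: le_trans (ler_normD _ _) _.
  apply: le_trans (lerD (ler_normD _ _) (lexx _)) _.
  by rewrite (ger0_norm y0) (ger0_norm v0); move: v1; lra.
apply: le_trans (average (q := q) (c := e * (2 + 2 * `|w|)) _ _) _.
- by rewrite mulr_ge0// addr_ge0// mulr_ge0.
- move=> y /andP[y0 ye].
  have -> : q y - `|w| * (v + w) = (`|w - y| - `|w|) * (v + w + y) + `|w| * y.
    by rewrite /q; ring.
  apply: le_trans (ler_normD _ _) _; rewrite 2!normrM normr_id (gtr0_norm y0).
  have H1 : `| `|w - y| - `|w| | <= y.
    apply: le_trans (ler_dist_dist _ _) _.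
    by rewrite addrAC subrr sub0r normrN gtr0_norm.
  have H2 := vw y (ltW y0) (le_trans (ltW ye) e_le1).
  have H3 := ler_pM (normr_ge0 _) (normr_ge0 _) H1 H2.
  apply: le_trans (lerD H3 (lexx _)) _.
  have : 0 <= e - y by rewrite subr_ge0 ltW.
  by move=> /(fun k => mulr_ge0 k W0) /=; lra.
have H : `| `|w| * (v + w)| <= `|w| * (1 + `|w|).
  rewrite normrM normr_id ler_wpM2l//; apply: le_trans (ler_normD _ _) _.
  by rewrite (ger0_norm v0) lerD2r.
have := ler_wpM2r Kh0 H.
have := mulr_ge0 e0 W0; have := mulr_ge0 Kh0 W0.
have e1' : 0 <= 1 - e by rewrite subr_ge0.
have := mulr_ge0 Kh0 e1'; have := mulr_ge0 Kh0 (sqr_ge0 `|w|).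
have := mulr_ge0 (mulr_ge0 Kh0 e1') W0.
have := mulr_ge0 e0 (sqr_ge0 `|w|).
rewrite /err; have := e0; have := Kh0; nra.
Qed.

(* dC is the derivative of C away from the kink y = w.  Since C vanishes at both
   ends of the grid, the Riemann sum of dC is small: this is the integration by
   parts in k, and what remains of the source is sg (w - y) * y * rho y = O(e). *)
Let E y := (v + w + y) * rho y.
Let dE y := rho y + (v + w + y) * drho y.
Let C y := `|w - y| * E y.
Let dC y := - Num.sg (w - y) * E y + `|w - y| * dE y.

Let telescopeC : \sum_(0 <= j < N) (C (z j + h) - C (z j)) = 0.
Proof.
have rhoN : rho (z N) = 0.
  apply: rho_supp; rewrite negb_and -!leNgt /z Nh orbC.
  by apply/orP; left; move: v0 v1 e_le1; lra.
have rho0 : rho (z 0%N) = 0.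
  apply: rho_supp; rewrite negb_and -!leNgt /z mul0r.
  by apply/orP; left; move: v0 v1 e_le1; lra.
rewrite (eq_bigr (fun j => C (z j.+1) - C (z j))); last by move=> j _; rewrite zS.
by rewrite (telescope_sumr (fun j => C (z j)))// /C /E rhoN rho0 !mulr0 subrr.
Qed.

Let stepC j : (j < N)%N -> `|C (z j + h) - C (z j) - h * dC (z j)| <=
  ((`|w| + 2) * (`|w| + 6) + (`|w| + 4)) * K * h ^+ 2
  + (`|w| + 3) * K * (2 * h * ((z j <= w)%R%:R - (z j + h <= w)%R%:R)).
Proof.
move=> jN; have [zj1 zj2] := z_rng jN.
set y := z j in zj1 zj2 *.
(* Discrete product rule for |w - y| E(y): the Taylor remainder of E, the change of |w - y| times h
   dE, and E(y) times the defect at the kink. The first two are O(h^2); only the last can be of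
   order h, and [normr_kink] controls it. *)
have -> : C (y + h) - C y - h * dC y =
    `|w - (y + h)| * ((v + w + y) * (rho (y + h) - rho y - h * drho y)
                      + h * (rho (y + h) - rho y))
    + (`|w - (y + h)| - `|w - y|) * (h * dE y)
    + E y * (`|w - (y + h)| - `|w - y| + h * Num.sg (w - y)).
  by rewrite /C /dC /E /dE; ring.
have hge0 := ltW h0; have hle2 := h2; have yle2 : y <= 2 by lra.
have ny : `|y + h| <= 2 by rewrite ler_norml; apply/andP; split; lra.
have n1 : `|w - (y + h)| <= `|w| + 2 by apply: le_trans (ler_normB _ _) _; lra.
have n2 : `|v + w + y| <= `|w| + 3.
  apply: le_trans (ler_normD _ _) _; apply: le_trans (lerD (ler_normD _ _) (lexx _)) _.
  have : `|y| <= 2 by rewrite ler_norml; apply/andP; split; lra.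
  by rewrite (ger0_norm v0); move: v1; lra.
have n3 := taylor_rho zj1 hge0 zj2.
have n4 : rho y <= K by apply: rho_le; apply/andP.
have n5 : `|drho y| <= K by apply: drho_le; apply/andP.
have n6 : `|rho (y + h) - rho y| <= 3 * h * K.
  have -> : rho (y + h) - rho y = (rho (y + h) - rho y - h * drho y) + h * drho y.
    by ring.
  apply: le_trans (ler_normD _ _) _; rewrite normrM (gtr0_norm h0).
  have := ler_wpM2l hge0 n5; have : 0 <= (2 - h) * (K * h).
    by rewrite mulr_ge0 ?subr_ge0.
  by rewrite expr2 in n3 *; lra.
have n7 : `|dE y| <= (`|w| + 4) * K.
  apply: le_trans (ler_normD _ _) _; rewrite normrM (ger0_norm (rho_ge0 y)).
  by have := ler_pM (normr_ge0 _) (normr_ge0 _) n2 n5; lra.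
have n8 : `|E y| <= (`|w| + 3) * K.
  by rewrite normrM (ger0_norm (rho_ge0 y)) ler_pM.
have n9 : `| `|w - (y + h)| - `|w - y| | <= h.
  apply: le_trans (ler_dist_dist _ _) _.
  rewrite (_ : w - (y + h) - (w - y) = - h); last ring.
  by rewrite normrN (gtr0_norm h0).
have n10 := normr_kink w y hge0.
apply: le_trans (ler_normD _ _) _; rewrite (normrM (E y)).
apply: lerD; last by rewrite ler_pM.
apply: le_trans (ler_normD _ _) _.
rewrite (normrM `|w - (y + h)|) normr_id (normrM (_ - _) (h * _)) (normrM h).
rewrite (gtr0_norm h0).
have n11 : `|(v + w + y) * (rho (y + h) - rho y - h * drho y)
    + h * (rho (y + h) - rho y)| <= (`|w| + 6) * (K * h ^+ 2).
  apply: le_trans (ler_normD _ _) _; rewrite 2!normrM (gtr0_norm h0).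
  have := ler_pM (normr_ge0 _) (normr_ge0 _) n2 n3; have := ler_wpM2l hge0 n6.
  by rewrite expr2; lra.
apply: (@le_trans _ _ ((`|w| + 2) * ((`|w| + 6) * (K * h ^+ 2))
    + h * (h * ((`|w| + 4) * K)))); last by rewrite expr2; lra.
apply: lerD; first exact: ler_pM.
by apply: ler_pM => //; [rewrite mulr_ge0|rewrite ler_wpM2l].
Qed.

Lemma grid_source :
  `|h * \sum_(0 <= j < N) (`|w - z j| * (v + w + z j) * drho (z j)
       - Num.sg (w - z j) * (v + z j) * rho (z j))| <= err.
Proof.
rewrite (eq_bigr (fun j => dC (z j) + (Num.sg (w - z j) * z j) * rho (z j))); last first.
  move=> j _; rewrite /dC /E /dE.
  by have := normrEsg (w - z j) => ->; ring.
rewrite big_split/= mulrDr.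
have -> : h * \sum_(0 <= j < N) dC (z j) =
    - \sum_(0 <= j < N) (C (z j + h) - C (z j) - h * dC (z j)).
  by rewrite [in RHS]big_split/= sumrN -mulr_sumr telescopeC sub0r opprK.
have S1 := average (q := fun y => Num.sg (w - y) * y) (q0 := 0) e0.
apply: le_trans (ler_normD _ _) _; rewrite normrN.
have {}S1 : `|h * \sum_(0 <= j < N) Num.sg (w - z j) * z j * rho (z j)|
    <= e * (1 + 2 * K * h).
  rewrite -[X in `|X|]subr0; apply: le_trans (S1 _) _.
    move=> y /andP[y0 ye]; rewrite subr0 normrM (gtr0_norm y0).
    apply: (@le_trans _ _ (1 * y)); last by rewrite mul1r ltW.
    by rewrite ler_wpM2r ?(ltW y0)// normr_sg; case: (_ != 0).
  by rewrite normr0 mul0r addr0.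
(* The quadratic errors sum to N h^2 = 2 h times their constant. The kink terms telescope to a
   difference of two indicators, at most 1, so together they cost no more than a single step. *)
have S2 : `|\sum_(0 <= j < N) (C (z j + h) - C (z j) - h * dC (z j))| <=
    ((`|w| + 2) * (`|w| + 6) + (`|w| + 4)) * K * (2 * h) + (`|w| + 3) * K * (2 * h).
  apply: le_trans (ler_norm_sum _ _ _) _.
  rewrite big_nat; apply: le_trans (ler_sum _ (fun j jN => stepC (andP jN).2)) _.
  rewrite -big_nat big_split/= sumr_const_nat subn0; apply: lerD.
    by rewrite -mulr_natl expr2 -{3}Nh le_eqVlt; apply/orP; left; apply/eqP; ring.
  rewrite -mulr_sumr -mulr_sumr ler_wpM2l ?mulr_ge0 ?addr_ge0//.
  rewrite -[leRHS]mulr1 ler_wpM2l ?mulr_ge0 ?(ltW h0)//.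
  rewrite -[leLHS]opprK -sumrN.
  rewrite (eq_bigr (fun j => (z j.+1 <= w)%R%:R - (z j <= w)%R%:R)); last first.
    by move=> j _; rewrite zS opprB.
  rewrite (telescope_sumr (fun j => (z j <= w)%R%:R))// opprB.
  by case: (z 0%N <= w); case: (z N <= w); rewrite /= ?mulr1n ?mulr0n; lra.
have := S1; have := S2; have e1' : 0 <= 1 - e by rewrite subr_ge0.
have := mulr_ge0 Kh0 e1'; have := mulr_ge0 Kh0 (sqr_ge0 `|w|).
have := mulr_ge0 Kh0 W0; have := mulr_ge0 e0 W0.
have := mulr_ge0 e0 (sqr_ge0 `|w|); have := e0; have := Kh0.
rewrite /err; lra.
Qed.

End grid.
End riemann.

Section kernel_grid.
Context {R : realType} (S : smooth_step R).

(** N depends on e alone. Uniformity in v is essential: the constants k = j h cannot depend on x,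
    whereas v = V(x) shifts the grid from point to point. Uniformity in w, up to the quadratic
    weight, allows for unbounded n. *)
Lemma kernel_grid (e : R) : 0 < e -> e <= 1 ->
  exists N, (0 < N)%N /\ forall v w, 0 <= v <= 1 ->
  let h := 2 / N%:R in let z (j : nat) := j%:R * h - v in
  let rho := kern S 0 e in let err := 3 * e * (1 + `|w|) ^+ 2 in
  [/\ `|h * \sum_(0 <= j < N) `|w - z j| * rho (z j) - `|w| | <= err,
      `|h * \sum_(0 <= j < N) (`|w - z j| * (v + w + z j)) * rho (z j)
         - `|w| * (v + w)| <= err &
      `|h * \sum_(0 <= j < N) (`|w - z j| * (v + w + z j) * derive1 rho (z j)
          - Num.sg (w - z j) * (v + z j) * rho (z j))| <= err].
Proof.
move=> e0 e1; set rho := kern S 0 e.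
have sr : smooth rho by exact: smooth_kern.
have [K1 K10 H1] := smooth_taylor1 (-1) 2 (smooth_stept S 0 e).
have [K2 K20 H2] := smooth_taylor1 (-1) 2 sr.
have [K3 K30 H3] := segment_bounded (-1) 2 (smooth_continuous sr).
have [K4 K40 H4] := segment_bounded (-1) 2 (smooth_continuous (smooth_derive1 sr)).
rewrite derive1_stept in H1.
pose K := K1 + K2 + K3 + K4.
have K0 : 0 <= K by rewrite !addr_ge0.
have [K1K K2K K3K K4K] : [/\ K1 <= K, K2 <= K, K3 <= K & K4 <= K].
  by rewrite /K; split; lra.
(* This makes 42 K h = 84 K / N at most e, so that 2 e + 42 K h becomes the 3 e of the statement. *)
pose N := (Num.bound (84 * K / e)).+1.
have N0 : 0 < N%:R :> R by rewrite ltr0n.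
have KN : 42 * K * (2 / N%:R) <= e.
  rewrite mulrA ler_pdivrMr// -ler_pdivrMl//.
  have -> : e^-1 * (42 * K * 2) = 84 * K / e by field; rewrite gt_eqF.
  apply: le_trans (ltW (archi_boundP _)) _.
    by rewrite divr_ge0 ?(ltW e0)// mulr_ge0.
  by rewrite ler_nat.
exists N; split => // v w v01 h z rho' err.
have errE : (2 * e + 42 * K * h) * (1 + `|w|) ^+ 2 <= err.
  by rewrite ler_wpM2r ?sqr_ge0//; rewrite /h; lra.
have e01 : 0 <= e <= 1 by rewrite (ltW e0).
have P0 x : x <= 0 -> stept S 0 e x = 0 by exact: stept0.
have P1 x : e <= x -> stept S 0 e x = 1.
  by move=> ex; apply: stept1 => //; rewrite add0r.
have r0 x : 0 <= rho x by exact: kern_ge0.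
have rs x : ~~ (0 < x < e) -> rho x = 0.
  by move=> xe; apply: kern_supp => //; rewrite add0r.
have tP x k : -1 <= x -> 0 <= k -> x + k <= 2 ->
    `|stept S 0 e (x + k) - stept S 0 e x - k * rho x| <= K * k ^+ 2.
  by move=> ? ? ?; apply: le_trans (H1 _ _ _ _ _) _ => //; rewrite ler_wpM2r ?sqr_ge0.
have tr x k : -1 <= x -> 0 <= k -> x + k <= 2 ->
    `|rho (x + k) - rho x - k * derive1 rho x| <= K * k ^+ 2.
  by move=> ? ? ?; apply: le_trans (H2 _ _ _ _ _) _ => //; rewrite ler_wpM2r ?sqr_ge0.
have rK x : -1 <= x <= 2 -> rho x <= K.
  by move=> /H3 h3; apply: le_trans (ler_norm _) _; exact: le_trans h3 K3K.
have drK x : -1 <= x <= 2 -> `|derive1 rho x| <= K.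
  by move=> /H4 h4; exact: le_trans h4 K4K.
split; apply: le_trans errE.
- by apply: (grid_abs (P := stept S 0 e) (rho := rho)).
- by apply: (grid_flux (P := stept S 0 e) (rho := rho)).
- by apply: (grid_source (P := stept S 0 e) (rho := rho) (drho := derive1 rho)).
Qed.

End kernel_grid.

(** * Integrals over a product *)

Section measure.
Context {R : realType}.

(* With the convention +oo - +oo = -oo, a finite integral converges absolutely. *)
Lemma fin_num_integrable d (X : measurableType d)
    (mu : {measure set X -> \bar R}) (A : set X) (f : X -> \bar R) :
  measurable A -> measurable_fun A f ->
  (\int[mu]_(x in A) f x)%E \is a fin_num -> mu.-integrable A f.
Proof.
move=> mA mf; rewrite integralE => fin; apply/integrableP; split => //.
rewrite -[fun x => _]/(abse \o f) fune_abse ge0_integralD//; last 2 first.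
  exact: measurable_funepos.
  exact: measurable_funeneg.
have : (0 <= \int[mu]_(x in A) (f^\+ x))%E by exact: integral_ge0.
have : (0 <= \int[mu]_(x in A) (f^\- x))%E by exact: integral_ge0.
move: fin; case: (\int[mu]_(x in A) (f^\+ x))%E => [a||];
  case: (\int[mu]_(x in A) (f^\- x))%E => [b||] //= _ _ _.
by rewrite -EFinD ltry.
Qed.

Lemma ae_lebS (P Q : R -> Prop) : (forall x, P x -> Q x) ->
  {ae leb R, forall x, P x} -> {ae leb R, forall x, Q x}.
Proof. by move=> PQ; apply: filterS PQ; exact: (ae_filter_ringOfSetsType (leb R)). Qed.

Lemma ae_lebS2 (P Q S : R -> Prop) : (forall x, P x -> Q x -> S x) ->
  {ae leb R, forall x, P x} -> {ae leb R, forall x, Q x} ->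
  {ae leb R, forall x, S x}.
Proof. by move=> PQ; apply: filterS2 PQ; exact: (ae_filter_ringOfSetsType (leb R)). Qed.

Implicit Types A B : set R.

(** The sign is known for each t outside a null set of x that depends on t. Tonelli, applied to the
    negative part, shows that this part has integral 0 over the product. *)
Lemma slices_Rintegral_ge0 A B (g : R * R -> R) : measurable A -> measurable B ->
  measurable_fun (A `*` B) g ->
  (forall t, A t -> {ae leb R, forall x, B x -> 0 <= g (t, x)}) ->
  0 <= \int[leb2 R]_(p in A `*` B) g p.
Proof.
move=> mA mB mg gpos; apply: fine_ge0.
have mAB := measurableX mA mB.
rewrite integral_mkcond integralE.
set f := _ \_ _.
have mf : measurable_fun setT f.
  by apply/(measurable_restrictT _ mAB); exact/measurable_EFinP.
rewrite (_ : (\int[_]_(x in _) (f^\- x))%E = 0%E) ?sube0; first exact: integral_ge0.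
have mfn := measurable_funeneg mf.
rewrite fubini_tonelli1//.
rewrite -[RHS](@integral0 _ _ _ (leb R) setT); apply: eq_integral => t _.
rewrite /fubini_F -[RHS](@integral0 _ _ _ (leb R) setT).
apply: ae_eq_integral => //.
  exact: (measurableT_comp mfn (measurable_pair1 t)).
have [At|nAt] := pselect (A t).
  apply: ae_lebS (gpos t At) => x gx _; rewrite /f funenegE patchE.
  case: ifPn; rewrite ?oppe0 ?maxxx// inE/= => -[_ Bx].
  by apply/max_idPr; rewrite /= lee_fin oppr_le0 gx.
apply/aeW => x _; rewrite /f funenegE patchE ifN ?oppe0 ?maxxx//.
by apply/negP; rewrite inE/= => -[].
Qed.

(** Integrability is asked of every slice, because a real-valued inner integral is [fine] of the
    extended one and would replace an infinite value by 0. *)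
Lemma Rintegral_fubini A B (g : R * R -> R) : measurable A -> measurable B ->
  (leb2 R).-integrable (A `*` B) (EFin \o g) ->
  (forall t, A t -> (leb R).-integrable B (fun x => (g (t, x))%:E)) ->
  (leb R).-integrable A
    (fun t => (\int[leb R]_(x in B) g (t, x))%:E) /\
  \int[leb2 R]_(p in A `*` B) g p =
    \int[leb R]_(t in A) \int[leb R]_(x in B) g (t, x).
Proof.
move=> mA mB ig igt.
have mAB : measurable (A `*` B : set (measurableTypeR R * measurableTypeR R)).
  exact: measurableX.
pose f := (EFin \o g) \_ (A `*` B).
have igf : (leb2 R).-integrable setT f.
  exact: (iffLR (integrable_mkcond _ mAB) ig).
have slice t : (\int[leb R]_x f (t, x) =
    ((fun t => (\int[leb R]_(x in B) g (t, x))%:E) \_ A) t)%E.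
  rewrite patchE; case: ifPn => At.
    rewrite fineK; last first.
      by apply: integrable_fin_num => //; apply: igt; move: At; rewrite inE.
    rewrite [RHS]integral_mkcond; apply: eq_integral => x _.
    by rewrite /f !patchE in_setX/= At.
  rewrite -[RHS](@integral0 _ _ _ (leb R) setT); apply: eq_integral => x _.
  by rewrite /f patchE in_setX/= (negPf At).
have HF := integrable_fubini_F igf; have HE := integral12_prod_meas1 igf.
split.
  have mA' : measurable (A : set (measurableTypeR R)) by [].
  apply: (iffRL (integrable_mkcond _ mA')); apply: eq_integrable HF => // t _.
  exact: slice.
rewrite /Rintegral; congr fine; rewrite integral_mkcond -HE [RHS]integral_mkcond.
by apply: eq_integral => t _; exact: slice.
Qed.

End measure.

(** * Integrability of the square of a solution *)

Ltac meas := repeat first [assumption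
  | match goal with |- measurable_fun _ (fun x => @?f x + - @?g x) =>
      apply: (@measurable_funB _ _ _ _ f g) end
  | match goal with |- measurable_fun _ (fun x => @?f x + @?g x) =>
      apply: (@measurable_funD _ _ _ _ f g) end
  | match goal with |- measurable_fun _ (fun x => @?f x * @?g x) =>
      apply: (@measurable_funM _ _ _ _ f g) end].

Section solution.
Context {R : realType}.
Variables (T : R) (n : R -> R -> R).
Hypothesis sol : entropy_solution_on T n.
Variable S : smooth_step R.

Local Notation M2 := (measurableTypeR R * measurableTypeR R)%type.
Local Notation D := (`]0%R, T[ `*` `]0%R, +oo[ : set M2).
Local Notation rect a b c d := (`[a, b]%classic `*` `[c, d]%classic : set M2).

Lemma measurable_D : measurable D.
Proof. exact: measurableX. Qed.

Lemma measurable_rect (a b c d : R) : measurable (rect a b c d).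
Proof. exact: measurableX. Qed.
Hint Resolve measurable_D measurable_rect : core.

Lemma rect_D (a b c d : R) : 0 < a -> b < T -> 0 < c -> rect a b c d `<=` D.
Proof.
move=> a0 bT c0 [t x]/= []; rewrite !in_itv/= andbT => /andP[? ?] /andP[? ?].
split; lra.
Qed.

Lemma measurable_sol : measurable_fun D (fun p : M2 => n p.1 p.2).
Proof.
have /measurable_int/measurable_EFinP := entropy_L1 sol.
apply: measurable_funS; first exact: measurableX.
move=> [t x]/= []; rewrite !in_itv/= !andbT => /andP[? ?] ?; split; lra.
Qed.

Lemma measurable_t f : smooth f -> measurable_fun D (fun p : M2 => f p.1).
Proof.
move=> sf; apply: measurable_funTS.
apply: (measurableT_comp (f := f)); last exact: measurable_fst.
by apply: continuous_measurable_fun; exact: smooth_continuous.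
Qed.

Lemma measurable_x f : smooth f -> measurable_fun D (fun p : M2 => f p.2).
Proof.
move=> sf; apply: measurable_funTS.
apply: (measurableT_comp (f := f)); last exact: measurable_snd.
by apply: continuous_measurable_fun; exact: smooth_continuous.
Qed.

Definition V (x : R) : R := 2 * x - x ^+ 2.

Lemma smooth_V : smooth V.
Proof.
apply: smoothB; first by apply: smoothM; [exact: smooth_cst|exact: smooth_id].
by apply: smoothM; exact: smooth_id.
Qed.

Lemma derive1_V x : derive1 V x = 2 - 2 * x.
Proof.
apply: derive1_val.
have H := is_deriveB (is_deriveM (is_derive_cst (2:R) x 1) (is_derive_id x 1))
   (is_deriveM (is_derive_id x 1) (is_derive_id x 1)).
apply: (is_derive_eq H); rewrite /GRing.scale/=; ring.
Qed.

Lemma V_bounds (x : R) : 0 <= x <= 2 -> 0 <= V x <= 1.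
Proof.
move=> /andP[x0 x2]; rewrite /V; have := sqr_ge0 (1 - x).
have : 0 <= x * (2 - x) by rewrite mulr_ge0; lra.
by rewrite !expr2; lra.
Qed.

Lemma fluxE x k : flux x k = k * (V x - k).
Proof. by rewrite /flux /V; ring. Qed.

Lemma dominated_integrable (a b c d : R) (g q : M2 -> R) :
  0 < a -> b < T -> 0 < c ->
  measurable_fun D g -> (leb2 R).-integrable (rect a b c d) (EFin \o q) ->
  (forall p, rect a b c d p -> `|g p| <= q p) ->
  (forall p, D p -> ~ rect a b c d p -> g p = 0) ->
  (leb2 R).-integrable D (EFin \o g).
Proof.
move=> a0 bT c0 mg iq gq g0.
have iqr := iffLR (integrable_mkcond _ (measurable_rect a b c d)) iq.
apply: le_integrable (integrableS _ _ _ iqr) => //.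
  exact/measurable_EFinP.
move=> p Dp /=; rewrite patchE; case: ifPn => [|/negP]; rewrite inE.
  move=> /gq h; rewrite lee_fin; apply: le_trans h _; exact: ler_norm.
by move=> /(g0 p Dp) ->.
Qed.

Lemma off_rectangle (f g : R -> R) (a b c d : R) (p : M2) :
  supported f a b -> supported g c d -> ~ rect a b c d p -> f p.1 * g p.2 = 0.
Proof.
move=> fab gcd /not_andP[|] /negP; rewrite in_itv/=.
  by move=> /fab ->; rewrite mul0r.
by move=> /gcd ->; rewrite mulr0.
Qed.

Lemma sol_rect_integrable (a b c d : R) : 0 < a -> b < T -> 0 < c ->
  (leb2 R).-integrable (rect a b c d) (fun p => (n p.1 p.2)%:E).
Proof.
move=> a0 bT c0; apply: integrableS (entropy_L1 sol) => //; first exact: measurableX.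
move=> [t x]/= []; rewrite !in_itv/= !andbT => /andP[? ?] /andP[? ?]; split; lra.
Qed.

Lemma rect_fin (a b c d : R) : (leb2 R (rect a b c d) < +oo)%E.
Proof.
rewrite (product_measure1E (leb R) (leb R))//= !lebesgue_measure_itv/=.
by rewrite -!EFinB; do 2 case: ifPn => _; rewrite ?mul0e ?mule0// -EFinM ltry.
Qed.

(** The extended integral in [entropy_weak] equals 0, in particular it is finite; by
    [fin_num_integrable] the integrand is therefore integrable. *)
Lemma test_weak (f g : R -> R) (a b c d : R) : smooth f -> smooth g ->
  0 < a -> b < T -> 0 < c -> supported f a b -> supported g c d ->
  (leb2 R).-integrable D (fun p => (n p.1 p.2 * (derive1 f p.1 * g p.2)
     + n p.1 p.2 * (V p.2 - n p.1 p.2) * (f p.1 * derive1 g p.2))%:E) /\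
  \int[leb2 R]_(p in D) (n p.1 p.2 * (derive1 f p.1 * g p.2)
     + n p.1 p.2 * (V p.2 - n p.1 p.2) * (f p.1 * derive1 g p.2)) = 0.
Proof.
move=> sf sg a0 bT c0 fab gcd.
have := entropy_weak sol (test_function_prod sf sg a0 bT c0 fab gcd).
rewrite pdt_prod// pdx_prod//.
under eq_integral do rewrite fluxE.
move=> E; split; last by rewrite /Rintegral E.
apply: fin_num_integrable; [by []| |by rewrite E].
apply/measurable_EFinP.
have mn := measurable_sol; have mV := measurable_x smooth_V.
have mf := measurable_t sf; have mg := measurable_x sg.
have mf' := measurable_t (smooth_derive1 sf).
have mg' := measurable_x (smooth_derive1 sg).
by meas.
Qed.

(* Tested with a function equal to x on the rectangle, the equation says that
   the flux V n - n^2 is integrable there. *)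
Lemma sq_integrable (a b c d : R) : 0 < a -> a <= b -> b < T -> 0 < c -> c <= d ->
  (leb2 R).-integrable (rect a b c d) (fun p => (n p.1 p.2 ^+ 2)%:E).
Proof.
move=> a0 ab bT c0 cd.
(* With this width the plateau in time is 1 on [a, b] while its support [a / 2, b + e] stays inside
   (0, T). *)
pose e := Num.min (a / 2) ((T - b) / 2).
have e0 : 0 < e by rewrite lt_min !divr_gt0// subr_gt0.
have ea : e <= a / 2 by rewrite ge_min lexx.
have eT : e <= (T - b) / 2 by rewrite ge_min lexx orbT.
have c20 : 0 < c / 2 by rewrite divr_gt0.
pose f := plateau S (a / 2) b e.
pose z := plateau S (c / 2) d (c / 2).
pose g := fun x : R => x * z x.
have sf : smooth f by exact: smooth_plateau.
have sz : smooth z by exact: smooth_plateau.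
have sg : smooth g by apply: smoothM => //; exact: smooth_id.
have f1 t : a <= t <= b -> f t = 1.
  by move=> /andP[? ?]; apply: plateau1 => //; apply/andP; split; lra.
have z1 x : c <= x <= d -> z x = 1.
  by move=> /andP[? ?]; apply: plateau1 => //; apply/andP; split; lra.
have f'0 t : a <= t <= b -> derive1 f t = 0.
  move=> /andP[? ?]; rewrite derive1_plateau !kern_supp ?subrr//.
    by rewrite negb_and -!leNgt; apply/orP; left.
  by rewrite negb_and -!leNgt; apply/orP; right; lra.
have z'0 x : c <= x <= d -> derive1 z x = 0.
  move=> /andP[? ?]; rewrite derive1_plateau !kern_supp ?subrr//.
    by rewrite negb_and -!leNgt; apply/orP; left.
  by rewrite negb_and -!leNgt; apply/orP; right; lra.
have g'1 x : c <= x <= d -> derive1 g x = 1.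
  move=> cxd; have H := is_deriveM (is_derive_id x 1) (smooth_is_derive x sz).
  rewrite (@derive1_val _ g _ _ H) /GRing.scale/= z'0// z1//.
  by rewrite mulr0 add0r mulr1.
have fs : supported f (a / 2) (b + e) by apply: plateau_supp => //; lra.
have gs : supported g (c / 2) (d + c / 2).
  by move=> x /(plateau_supp S c20 (_ : c / 2 <= d)) zx; rewrite /g /z zx ?mulr0//; lra.
have a20 : 0 < a / 2 by lra.
have beT : b + e < T by lra.
have [iw _] := test_weak sf sg a20 beT c20 fs gs.
have iw' := integrableS measurable_D (measurable_rect a b c d) (rect_D a0 bT c0) iw.
have iV : (leb2 R).-integrable (rect a b c d) (fun p => (V p.2 * n p.1 p.2)%:E).
  apply: (@integrableMr _ _ _ (leb2 R) _ _ (fun p : M2 => V p.2)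
    (fun p : M2 => (n p.1 p.2)%:E)); first by [].
  - apply: measurable_funS (measurable_x smooth_V) => //; exact: rect_D.
  - have [M M0 HM] := segment_bounded c d (smooth_continuous smooth_V).
    exists M; split; first exact: num_real.
    move=> m Mm p [_]; rewrite /= in_itv/= => /HM h.
    exact: le_trans h (ltW Mm).
  - exact: sol_rect_integrable.
apply: eq_integrable (integrableB _ iV iw') => // p; rewrite inE => -[] /=.
rewrite !in_itv/= => pa pc; rewrite -EFinB f'0// f1// g'1//; congr EFin; ring.
Qed.

Lemma bound_integrable (a b c d C : R) :
  0 < a -> a <= b -> b < T -> 0 < c -> c <= d ->
  (leb2 R).-integrable (rect a b c d) (fun p => (C * (1 + n p.1 p.2 ^+ 2))%:E).
Proof.
move=> a0 ab bT c0 cd; have mr := measurable_rect a b c d.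
have i1 : (leb2 R).-integrable (rect a b c d) (EFin \o cst C).
  apply: measurable_bounded_integrable => //; first exact: rect_fin.
  exists `|C|; split; first exact: num_real.
  by move=> m Cm p _ /=; exact: ltW.
have i2 := integrableZl mr C (sq_integrable a0 ab bT c0 cd).
apply: eq_integrable (integrableD mr i1 i2) => //.
by move=> p _ /=; rewrite -EFinM -EFinD mulrDr mulr1.
Qed.

Lemma measurable_sg (g : M2 -> R) : measurable_fun D g ->
  measurable_fun D (fun p => Num.sg (g p)).
Proof.
move=> mg.
rewrite (_ : (fun p => _) = fun p => if 0 < g p then 1 else if g p < 0 then -1 else 0).
  apply: measurable_fun_if => //; first exact: measurable_fun_ltr.
  have mD0 : measurable (D `&` (fun p => 0 < g p) @^-1` [set false]).
    by have := @measurable_fun_ltr _ _ _ D (cst 0) g (measurable_cst _) mg; exact.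
  apply: measurable_fun_if => //.
  by apply: measurable_fun_ltr => //; apply: measurable_funS mg => //; exact: subIsetl.
by apply/funext => p; case: sgrP => //.
Qed.

Lemma sum_Rintegral_ge0 (F : nat -> M2 -> R) N :
  (forall j, (leb2 R).-integrable D (EFin \o F j)) ->
  (forall j, 0 <= \int[leb2 R]_(p in D) F j p) ->
  (leb2 R).-integrable D (fun p => (\sum_(0 <= j < N) F j p)%:E) /\
  0 <= \int[leb2 R]_(p in D) \sum_(0 <= j < N) F j p.
Proof.
move=> iF F0; elim: N => [|N [iN IN]].
  split; last by apply: Rintegral_ge0 => p _; rewrite big_geq.
  by apply: eq_integrable (integrable0 _ _) => // p _; rewrite big_geq.
have E p : \sum_(0 <= j < N.+1) F j p = \sum_(0 <= j < N) F j p + F N p.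
  by rewrite big_nat_recr.
split.
  by apply: eq_integrable (integrableD _ iN (iF N)) => // p _ /=; rewrite E.
have -> : \int[leb2 R]_(p in D) \sum_(0 <= j < N.+1) F j p =
    \int[leb2 R]_(p in D) (\sum_(0 <= j < N) F j p + F N p).
  by apply: eq_Rintegral => p _; exact: E.
by rewrite RintegralD//; exact: addr_ge0.
Qed.

End solution.

#[local] Hint Resolve measurable_D measurable_rect : core.

(** * Kruzhkov's inequality with the steady profile *)

Section kruzhkov.
Context {R : realType}.
Variables (T : R) (n : R -> R -> R).
Hypothesis sol : entropy_solution_on T n.
Variable S : smooth_step R.

Local Notation M2 := (measurableTypeR R * measurableTypeR R)%type.
Local Notation D := (`]0%R, T[ `*` `]0%R, +oo[ : set M2).
Local Notation rect a b c d := (`[a, b]%classic `*` `[c, d]%classic : set M2).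

Variables (f g : R -> R) (a b c : R).
Hypotheses (sf : smooth f) (sg : smooth g).
Hypotheses (f0 : forall t, 0 <= f t) (g0 : forall x, 0 <= g x).
Hypotheses (a0 : 0 < a) (ab : a <= b) (bT : b < T) (c0 : 0 < c) (c2 : c <= 2).
Hypotheses (fab : supported f a b) (gc2 : supported g c 2).

Let w (p : M2) : R := n p.1 p.2 - V p.2.

Let f'ab : supported (derive1 f) a b.
Proof. exact: supported_derive1. Qed.

Let g'c2 : supported (derive1 g) c 2.
Proof. exact: supported_derive1. Qed.

Let off_rect (p : M2) : ~ rect a b c 2 p ->
  [/\ derive1 f p.1 * g p.2 = 0, f p.1 * derive1 g p.2 = 0 & f p.1 * g p.2 = 0].
Proof. by move=> nrp; split; apply: off_rectangle nrp. Qed.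

Let slope_le (x : R) : c <= x <= 2 -> `|2 - 2 * x| <= 2.
Proof. by move=> /andP[? ?]; rewrite ler_norml; have := c0; lra. Qed.

Let weight_bound : exists2 M, 0 <= M & forall p : M2, rect a b c 2 p ->
  [/\ `|derive1 f p.1 * g p.2| <= M, `|f p.1 * derive1 g p.2| <= M &
      `|f p.1 * g p.2 * (2 - 2 * p.2)| <= M].
Proof.
have [M1 M10 H1] := segment_bounded a b (smooth_continuous sf).
have [M2 M20 H2] := segment_bounded a b (smooth_continuous (smooth_derive1 sf)).
have [M3 M30 H3] := segment_bounded c 2 (smooth_continuous sg).
have [M4 M40 H4] := segment_bounded c 2 (smooth_continuous (smooth_derive1 sg)).
exists (M2 * M3 + M1 * M4 + M1 * M3 * 2); first by rewrite !addr_ge0// !mulr_ge0.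
move=> p [] /=; rewrite !in_itv/= => pt px.
have e1 := ler_pM (normr_ge0 _) (normr_ge0 _) (H2 _ pt) (H3 _ px).
have e2 := ler_pM (normr_ge0 _) (normr_ge0 _) (H1 _ pt) (H4 _ px).
have e3 := ler_pM (normr_ge0 _) (normr_ge0 _) (H1 _ pt) (H3 _ px).
have e4 : `|2 - 2 * p.2| <= 2 by exact: slope_le.
have e5 := ler_pM (mulr_ge0 (normr_ge0 _) (normr_ge0 _)) (normr_ge0 _) e3 e4.
have := mulr_ge0 M20 M30; have := mulr_ge0 M10 M40; have := mulr_ge0 M10 M30.
by rewrite !normrM; split; lra.
Qed.

Let V01 x : c <= x <= 2 -> 0 <= V x <= 1.
Proof. by move=> /andP[cx x2]; apply: V_bounds; rewrite x2 ltW// (lt_le_trans c0). Qed.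

Let mn := measurable_sol sol.
Let mV := @measurable_x _ T _ (@smooth_V R).

(** The entropy flux relative to V is sg(n - V) (F(x, n) - F(x, V)) = sg(n - V) n (V - n) = -|n - V|
    n. No source term appears, since the flux of V is constantly 0. *)
Let target (p : M2) : R := `|w p| * (derive1 f p.1 * g p.2)
  - `|w p| * n p.1 p.2 * (f p.1 * derive1 g p.2).

Let sqr_bound (p : M2) (L : R) : 1 <= L ->
  (`|n p.1 p.2| + L) ^+ 2 <= 2 * L ^+ 2 * (1 + n p.1 p.2 ^+ 2).
Proof.
move=> L1; rewrite -(real_normK (num_real (n p.1 p.2))).
set m := `|_|; have m0 : 0 <= m by exact: normr_ge0.
have H : 0 <= (L ^+ 2 - 1) * m ^+ 2.
  by rewrite mulr_ge0 ?sqr_ge0// subr_ge0 exprn_ege1.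
have := sqr_ge0 (m - L); rewrite !expr2 in H *; nra.
Qed.

Let target_integrable : (leb2 R).-integrable D (EFin \o target).
Proof.
have [M M0 HM] := weight_bound.
apply: (dominated_integrable (a := a) (b := b) (c := c) (d := 2)
   (q := fun p => 8 * 2 * M * (1 + n p.1 p.2 ^+ 2))) => //.
- have mw : measurable_fun D (fun p : M2 => `|w p|).
    by apply: measurableT_comp => //; exact: measurable_funB.
  have m1 := @measurable_t _ T _ sf; have m2 := @measurable_x _ T _ sg.
  have m3 := @measurable_t _ T _ (smooth_derive1 sf).
  have m4 := @measurable_x _ T _ (smooth_derive1 sg).
  by rewrite /target; meas.
- exact: (bound_integrable sol S).
- move=> p rp; have [h1 h2 _] := HM p rp.
  have [/= _ ] := rp; rewrite in_itv/= => /V01/andP[v0 v1].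
  have n1 : `|w p| <= `|n p.1 p.2| + 1.
    by apply: le_trans (ler_normB _ _) _; rewrite lerD2l ger0_norm.
  have H2 := @sqr_bound p 2 ltac:(lra).
  apply: le_trans (ler_normB _ _) _.
  rewrite (normrM `|w p|) (normrM (_ * _)) (normrM `|w p|) normr_id.
  have := ler_pM (normr_ge0 _) (normr_ge0 _) n1 h1.
  have e2 := ler_pM (normr_ge0 _) (normr_ge0 _) n1 (lexx `|n p.1 p.2|).
  have := ler_pM (mulr_ge0 (normr_ge0 _) (normr_ge0 _)) (normr_ge0 _) e2 h2.
  have := ler_wpM2r M0 H2.
  have := mulr_ge0 M0 (normr_ge0 (n p.1 p.2)).
  have := mulr_ge0 M0 (sqr_ge0 `|n p.1 p.2|).
  by lra.
- by move=> p _ /off_rect[e1 e2 _]; rewrite /target e1 e2 !mulr0 subrr.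
Qed.

Section kernel.
Variable e : R.
Let rho := kern S 0 e.

(* The entropy integrand for the constant k and the test function
   f(t) g(x) rho(k - V x), in the variables w = n - V and z = k - V. *)
Let G (k : R) (p : M2) : R := let z := k - V p.2 in
  `|w p - z| * rho z * (derive1 f p.1 * g p.2)
  - `|w p - z| * (V p.2 + w p + z) * rho z * (f p.1 * derive1 g p.2)
  + (`|w p - z| * (V p.2 + w p + z) * derive1 rho z
     - Num.sg (w p - z) * (V p.2 + z) * rho z) * (f p.1 * g p.2 * (2 - 2 * p.2)).

Let srho : smooth rho. Proof. exact: smooth_kern. Qed.

Let smooth_k (k : R) : smooth (fun x => k - V x).
Proof. by apply: smoothB; [exact: smooth_cst|exact: smooth_V]. Qed.

Let G_integrable k : (leb2 R).-integrable D (EFin \o G k).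
Proof.
have [M M0 HM] := weight_bound.
have [r1 r10 Hr1] := segment_bounded (k - 1) k (smooth_continuous srho).
have [r2 r20 Hr2] := segment_bounded (k - 1) k (smooth_continuous (smooth_derive1 srho)).
pose L := `|k| + 1; have L1 : 1 <= L by rewrite lerDr.
apply: (dominated_integrable (a := a) (b := b) (c := c) (d := 2)
   (q := fun p => (5 * M * (r1 + r2) * (2 * L ^+ 2)) * (1 + n p.1 p.2 ^+ 2))) => //.
- have m1 := @measurable_t _ T _ sf; have m2 := @measurable_x _ T _ sg.
  have m3 := @measurable_t _ T _ (smooth_derive1 sf).
  have m4 := @measurable_x _ T _ (smooth_derive1 sg).
  have m5 := @measurable_x _ T _ (smooth_k k).
  have m6 := @measurable_x _ T _ (smooth_comp srho (smooth_k k)).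
  have m7 := @measurable_x _ T _ (smooth_comp (smooth_derive1 srho) (smooth_k k)).
  have mw : measurable_fun D w by rewrite /w; meas.
  have mwz : measurable_fun D (fun p : M2 => w p - (k - V p.2)) by meas.
  have m8 : measurable_fun D (fun p : M2 => `|w p - (k - V p.2)|).
    exact: measurableT_comp.
  have m9 : measurable_fun D (fun p : M2 => Num.sg (w p - (k - V p.2))).
    exact: measurable_sg.
  have m10 : measurable_fun D (fun p : M2 => 2 - 2 * p.2).
    apply: (@measurable_x _ T (fun x => 2 - 2 * x)).
    apply: smoothB; first exact: smooth_cst.
    by apply: smoothM; [exact: smooth_cst|exact: smooth_id].
  by rewrite /G /=; meas.
- exact: (bound_integrable sol S).
- move=> p rp; have [h1 h2 h3] := HM p rp.
  have [/= _ ] := rp; rewrite in_itv/= => /V01/andP[v0 v1].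
  rewrite /G; set z := k - V p.2.
  have zk : k - 1 <= z <= k by rewrite /z; lra.
  have {}Hr1 := Hr1 _ zk; have {}Hr2 := Hr2 _ zk.
  set m := `|n p.1 p.2|; have m0 : 0 <= m by exact: normr_ge0.
  have E1 : w p - z = n p.1 p.2 - k by rewrite /w /z; ring.
  have E2 : V p.2 + w p + z = n p.1 p.2 + (k - V p.2) by rewrite /w /z; ring.
  have E3 : V p.2 + z = k by rewrite /z; ring.
  have n1 : `|w p - z| <= m + L.
    by rewrite E1; apply: le_trans (ler_normB _ _) _; rewrite lerD2l lerDl.
  have n2 : `|V p.2 + w p + z| <= m + L.
    rewrite E2; apply: le_trans (ler_normD _ _) _; rewrite lerD2l.
    by apply: le_trans (ler_normB _ _) _; rewrite lerD2l ger0_norm.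
  have n3 : `|Num.sg (w p - z) * (V p.2 + z)| <= m + L.
    rewrite E3 normrM normr_sg; apply: (@le_trans _ _ (1 * `|k|)).
      by rewrite ler_wpM2r//; case: (_ != 0).
    by rewrite mul1r; apply: ler_wpDl => //; rewrite lerDl.
  have H := sqr_bound p L1; rewrite -/m in H.
  have mL : m + L <= (m + L) ^+ 2.
    have ml1 : 1 <= m + L by lra.
    by rewrite expr2 ler_peMr// (le_trans ler01).
  have q0 : 0 <= (m + L) ^+ 2 by exact: sqr_ge0.
  have r0 : 0 <= r1 + r2 by exact: addr_ge0.
  have b12 : `|w p - z| * `|V p.2 + w p + z| <= (m + L) ^+ 2.
    by rewrite expr2 ler_pM.
  have rr1 : `|rho z| <= r1 + r2 by apply: le_trans Hr1 _; rewrite lerDl.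
  have rr2 : `|derive1 rho z| <= r1 + r2 by apply: le_trans Hr2 _; rewrite lerDr.
  have t1 : `| `|w p - z| * rho z * (derive1 f p.1 * g p.2)|
      <= (m + L) ^+ 2 * (r1 + r2) * M.
    rewrite (normrM (_ * _)) ler_pM// normrM ler_pM// normr_id.
    exact: le_trans n1 mL.
  have t2 : `| `|w p - z| * (V p.2 + w p + z) * rho z * (f p.1 * derive1 g p.2)|
      <= (m + L) ^+ 2 * (r1 + r2) * M.
    rewrite (normrM (_ * rho z)) ler_pM// (normrM (_ * _)) ler_pM//.
    by rewrite normrM normr_id.
  have t3 : `|(`|w p - z| * (V p.2 + w p + z) * derive1 rho z
     - Num.sg (w p - z) * (V p.2 + z) * rho z) * (f p.1 * g p.2 * (2 - 2 * p.2))|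
      <= ((m + L) ^+ 2 * (r1 + r2) + (m + L) ^+ 2 * (r1 + r2)) * M.
    rewrite (normrM (_ - _)) ler_pM//; apply: le_trans (ler_normB _ _) _.
    apply: lerD; rewrite normrM ler_pM//; first by rewrite normrM normr_id.
    exact: le_trans n3 mL.
  apply: le_trans (ler_normD _ _) _.
  apply: le_trans (lerD (ler_normB _ _) (lexx _)) _.
  apply: le_trans (lerD (lerD t1 t2) t3) _.
  have := ler_wpM2r (mulr_ge0 M0 r0) H.
  have : 0 <= M * (r1 + r2) * (2 * L ^+ 2 * (1 + n p.1 p.2 ^+ 2)).
    by rewrite !mulr_ge0// ?addr_ge0 ?sqr_ge0.
  by lra.
- by move=> p _ /off_rect[e1 e2 e3]; rewrite /G e1 e2 e3 !(mul0r, mulr0) subrr addr0.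
Qed.

(** Differentiating rho(k - V(x)) brings out -(2 - 2x), and F_x(x, k) = (2 - 2x) k has the same
    factor; so the term with rho' and the source combine into the last line of [G]. The flux term
    uses F(x, n) - F(x, k) = -(n - k) (n + k - V), where n + k - V = V + w + z. *)
Let G_ge0 k : 0 < e -> 0 <= \int[leb2 R]_(p in D) G k p.
Proof.
move=> e0; pose gk x := g x * rho (k - V x).
have sgk : smooth gk by apply: smoothM => //; exact: smooth_comp.
have gk2 : supported gk c 2 by move=> x /gc2 gx; rewrite /gk gx mul0r.
have := @entropy_ineq _ _ _ sol k _ (test_function_prod sf sgk a0 bT c0 fab gk2).
have fg0 t x : 0 <= f t * gk x by rewrite mulr_ge0// mulr_ge0//; exact: kern_ge0.
move=> /(_ fg0)/fine_ge0.
rewrite pdt_prod// pdx_prod//.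
suff E (p : M2) : G k p = `|n p.1 p.2 - k| * (derive1 f p.1 * gk p.2)
    + Num.sg (n p.1 p.2 - k) * (flux p.2 (n p.1 p.2) - flux p.2 k)
      * (f p.1 * derive1 gk p.2)
    - Num.sg (n p.1 p.2 - k) * flux_x p.2 k * (f p.1 * gk p.2).
  by rewrite (eq_Rintegral _ (fun p _ => E p)).
have dgk : derive1 gk p.2 = derive1 g p.2 * rho (k - V p.2)
    - g p.2 * ((2 - 2 * p.2) * derive1 rho (k - V p.2)).
  apply: derive1_val.
  have H1 := @is_derive1_comp _ rho (fun x => k - V x) (p.2 : R) _ _
    (smooth_is_derive (k - V p.2) srho) (smooth_is_derive (p.2 : R) (smooth_k k)).
  have H2 : derive1 (fun x => k - V x) (p.2 : R) = - (2 - 2 * p.2).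
    rewrite -derive1_V; apply: derive1_val.
    have := is_deriveB (is_derive_cst k (p.2 : R) 1)
      (smooth_is_derive (p.2 : R) (@smooth_V R)).
    by rewrite sub0r.
  apply: (is_derive_eq (is_deriveM (smooth_is_derive (p.2 : R) sg) H1)).
  by rewrite H2 /GRing.scale/=; ring.
rewrite /G dgk /gk !fluxE /flux_x /w.
have E1 : n p.1 p.2 - V p.2 - (k - V p.2) = n p.1 p.2 - k by ring.
rewrite E1 (normrEsg (n p.1 p.2 - k)); ring.
Qed.

(** The constant is 72 = 3 * 3 * 8: three estimates from [kernel_grid], each with error 3 e (1 +
    |w|)^2 M, and (1 + |w|)^2 <= 8 (1 + n^2) because V is in [0, 1] on the rectangle. *)
Let U (M : R) (p : M2) : R :=
  72 * M * (1 + n p.1 p.2 ^+ 2) * \1_(rect a b c 2) p.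

Let U_integrable M : (leb2 R).-integrable D (EFin \o U M).
Proof.
apply: (dominated_integrable (a := a) (b := b) (c := c) (d := 2)
   (q := fun p => 72 * `|M| * (1 + n p.1 p.2 ^+ 2))) => //.
- apply: measurable_funM; last exact: measurable_indic.
  have m1 : measurable_fun D (fun p : M2 => n p.1 p.2 ^+ 2).
    exact: measurable_funX.
  by meas.
- exact: (bound_integrable sol S).
- move=> p rp; rewrite /U indicE mem_set// mulr1 !normrM.
  rewrite (ger0_norm (_ : 0 <= 72)) ?(ger0_norm (_ : 0 <= 1 + n p.1 p.2 ^+ 2))//.
  by rewrite addr_ge0 ?sqr_ge0.
- by move=> p _ nrp; rewrite /U indicE memNset// mulr0.
Qed.

(** The inequalities for k = j h are added with weight h. By [kernel_grid] at v = V(x) and w = n -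
    V, the sum is pointwise at most [target] plus e times [U M]. *)
Lemma target_kernel M : 0 < e -> e <= 1 -> 0 <= M ->
  (forall p : M2, rect a b c 2 p ->
    [/\ `|derive1 f p.1 * g p.2| <= M, `|f p.1 * derive1 g p.2| <= M &
      `|f p.1 * g p.2 * (2 - 2 * p.2)| <= M]) ->
  0 <= \int[leb2 R]_(p in D) target p + e * \int[leb2 R]_(p in D)
    (72 * M * (1 + n p.1 p.2 ^+ 2) * \1_(rect a b c 2) p).
Proof.
move=> e0 e1 M0 HM; have [N [N0 HN]] := kernel_grid S e0 e1.
pose h : R := 2 / N%:R.
have h0 : 0 <= h by rewrite divr_ge0.
have [iG IG] := sum_Rintegral_ge0 N (fun j => G_integrable (j%:R * h))
  (fun j => G_ge0 (j%:R * h) e0).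
have ieU : (leb2 R).-integrable D (fun p => (e * U M p)%:E).
  by apply: eq_integrable (integrableZl (measurable_D T) e (U_integrable M)).
rewrite -RintegralZl//; last exact: U_integrable.
rewrite -RintegralD//.
apply: (@le_trans _ _ (\int[leb2 R]_(p in D) (h * \sum_(0 <= j < N) G (j%:R * h) p))).
  by rewrite RintegralZl// mulr_ge0.
apply: le_Rintegral => //.
- by apply: eq_integrable (integrableZl (measurable_D T) h iG).
- by apply: eq_integrable (integrableD (measurable_D T) target_integrable ieU).
move=> p Dp; have [rp|nrp] := pselect (rect a b c 2 p); last first.
  have [e1' e2' e3'] := off_rect nrp.
  rewrite /target /U indicE memNset// e1' e2' !mulr0 subrr addr0 big1 ?mulr0//.
  by move=> j _; rewrite /G e1' e2' e3' !(mul0r, mulr0) subrr addr0.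
have [h1 h2 h3] := HM p rp.
have [/= _ ] := rp; rewrite in_itv/= => /V01 v01.
have /= [] := HN (V p.2) (w p) v01; rewrite -/h -/rho.
set A1 := \sum_(_ <= _ < _) _; set A2 := \sum_(_ <= _ < _) _.
set A3 := \sum_(_ <= _ < _) _ => b1 b2 b3.
have -> : h * \sum_(0 <= j < N) G (j%:R * h) p =
    h * A1 * (derive1 f p.1 * g p.2) - h * A2 * (f p.1 * derive1 g p.2)
    + h * A3 * (f p.1 * g p.2 * (2 - 2 * p.2)).
  have -> : \sum_(0 <= j < N) G (j%:R * h) p = A1 * (derive1 f p.1 * g p.2)
      - A2 * (f p.1 * derive1 g p.2) + A3 * (f p.1 * g p.2 * (2 - 2 * p.2)).
    rewrite /A1 /A2 /A3 !(mulr_suml _ _ _ (_ * _)) -sumrB -big_split/=.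
    by apply: eq_bigr => j _; rewrite /G /=; ring.
  by ring.
have vw : V p.2 + w p = n p.1 p.2 by rewrite /w; ring.
rewrite vw in b2.
rewrite /target /U indicE mem_set// mulr1.
set m := n p.1 p.2 in b2 *.
have wm : `|w p| <= `|m| + 1.
  move: v01 => /andP[v0 v1].
  by apply: le_trans (ler_normB _ _) _; rewrite lerD2l ger0_norm.
have w0 := normr_ge0 (w p).
have E1 : (1 + `|w p|) ^+ 2 <= 8 * (1 + m ^+ 2).
  apply: le_trans (_ : (`|m| + 2) ^+ 2 <= _).
    have h12 : 1 + `|w p| <= `|m| + 2 by lra.
    by rewrite ler_sqr ?nnegrE ?addr_ge0.
  by have := @sqr_bound p 2 ltac:(lra); rewrite -/m; lra.
set r := (1 + `|w p|) ^+ 2 in b1 b2 b3 E1.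
have r0 : 0 <= 3 * e * r by rewrite mulr_ge0 ?sqr_ge0// mulr_ge0// ltW.
have c1 : (h * A1 - `|w p|) * (derive1 f p.1 * g p.2) <= 3 * e * r * M.
  by apply: le_trans (ler_norm _) _; rewrite normrM ler_pM.
have c2' : - ((h * A2 - `|w p| * m) * (f p.1 * derive1 g p.2)) <= 3 * e * r * M.
  by apply: le_trans (ler_norm _) _; rewrite normrN normrM ler_pM.
have c3 : h * A3 * (f p.1 * g p.2 * (2 - 2 * p.2)) <= 3 * e * r * M.
  by apply: le_trans (ler_norm _) _; rewrite normrM ler_pM.
have := ler_wpM2l (mulr_ge0 (ltW e0) M0) E1.
lra.
Qed.

End kernel.

(* As (n - V) has the sign of -F(x, n) = -(F(x, n) - F(x, V)), this is the
   entropy inequality with the constant k replaced by the steady profile V. *)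
Lemma kruzhkov_profile : (leb2 R).-integrable D (EFin \o target) /\
  0 <= \int[leb2 R]_(p in D) target p.
Proof.
split; first exact: target_integrable.
have [M M0 HM] := weight_bound.
pose I := \int[leb2 R]_(p in D)
  (72 * M * (1 + n p.1 p.2 ^+ 2) * \1_(rect a b c 2) p).
have I0 : 0 <= I.
  apply: Rintegral_ge0 => p _; rewrite !mulr_ge0// ?indicE//.
  by rewrite addr_ge0 ?sqr_ge0.
set A := \int[leb2 R]_(p in D) target p.
have HA e : 0 < e -> e <= 1 -> 0 <= A + e * I.
  by move=> e0 e1; exact: target_kernel.
rewrite leNgt; apply/negP => A0.
have I1 : 0 < 2 * (I + 1) by rewrite mulr_gt0// ltr_wpDl.
pose e := Num.min 1 (- A / (2 * (I + 1))).
have e0 : 0 < e by rewrite lt_min ltr01 divr_gt0// oppr_gt0.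
have e1 : e <= 1 by rewrite ge_min lexx.
have eA : e * (2 * (I + 1)) <= - A by rewrite -ler_pdivlMr// ge_min lexx orbT.
have := HA e e0 e1; have := mulr_ge0 (ltW e0) I0; lra.
Qed.

End kruzhkov.

(** * From the space-time inequality to monotonicity in time *)

Section evolution.
Context {R : realType} (S : smooth_step R).
Local Notation M2 := (measurableTypeR R * measurableTypeR R)%type.

Lemma continuous_Rintegrable (f : R -> R) (a b : R) : continuous f ->
  (leb R).-integrable `]a, b[ (EFin \o f).
Proof.
move=> cf; have i : (leb R).-integrable `[a, b] (EFin \o f).
  apply: continuous_compact_integrable; first exact: segment_compact.
  exact: continuous_subspaceT.
apply: integrableS i => //.
by move=> x /=; rewrite !in_itv/= => /andP[/ltW -> /ltW ->].
Qed.

Lemma Rintegral_derive1 (F : R -> R) (a b : R) : smooth F -> a < b ->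
  \int[leb R]_(x in `]a, b[) derive1 F x = F b - F a.
Proof.
move=> sF ab; rewrite /Rintegral.
have cF := smooth_continuous sF; have cF' := smooth_continuous (smooth_derive1 sF).
rewrite -(@integral_itv_bndoo _ a b _ true false); last first.
  by apply/measurable_EFinP; apply: measurable_funTS; exact: continuous_measurable_fun.
rewrite (@continuous_FTC2 _ _ F)//.
- exact: continuous_subspaceT.
- split; first by move=> x _; exact: smooth_derivable.
    by apply: cvg_at_right_filter; exact: cF.
  by apply: cvg_at_left_filter; exact: cF.
Qed.

Lemma le_of_half_gaps (x y e L : R) :
  x - e / 2 - (y + e / 2) <= L -> x <= y + L + e.
Proof. by lra. Qed.

(** The derivative of a plateau in time is a kernel just after its start minus a kernel just after
    its end, so testing against it nearly gives m a - m b. Test functions live at positive times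
    only; continuity of m from the right reaches a = 0. *)
Lemma evolution_le (H : R -> R -> R) (g : R -> R) (T L : R) :
  let m t := \int[leb R]_(x in `]0, +oo[) (H t x * g x) in
  (forall t, 0 <= t -> (leb R).-integrable `]0%R, +oo[ (fun x => (H t x * g x)%:E)) ->
  (forall t e, 0 <= t -> t < T -> 0 < e ->
    exists2 d, 0 < d & forall s, t <= s -> s <= t + d -> s <= T -> `|m s - m t| <= e) ->
  (forall a b e, 0 < a -> a <= b -> 0 < e -> b + e < T ->
    (leb2 R).-integrable (`]0%R, T[ `*` `]0%R, +oo[ : set M2)
      (fun p => (derive1 (plateau S a b e) p.1 * (H p.1 p.2 * g p.2))%:E) /\
    \int[leb2 R]_(p in (`]0%R, T[ `*` `]0%R, +oo[ : set M2))
      (derive1 (plateau S a b e) p.1 * (H p.1 p.2 * g p.2)) <= L) ->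
  forall a b, 0 <= a -> a <= b -> b < T -> m a <= m b + L.
Proof.
move=> m iH cm HL a b a0 ab bT; apply/ler_addgt0Pr => e e0.
have e2 : 0 < e / 2 by rewrite divr_gt0.
have [d1 d10 Hd1] := cm a _ a0 (le_lt_trans ab bT) e2.
have [d2 d20 Hd2] := cm b _ (le_trans a0 ab) bT e2.
(* The kernels sit on (a + k, a + 2k) and (b + k, b + 2k): 2k <= d1 and 2k <= d2 keep them where m
   is within e / 2 of its values at a and b, and 3k <= T - b leaves b + 2k < T. *)
pose k := Num.min (Num.min (d1 / 2) (d2 / 2)) ((T - b) / 3).
have k0 : 0 < k by rewrite !lt_min !divr_gt0// subr_gt0.
have kd1 : k <= d1 / 2 by rewrite /k !ge_min lexx.
have kd2 : k <= d2 / 2 by rewrite /k !ge_min lexx orbT.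
have kT : k <= (T - b) / 3 by rewrite /k !ge_min lexx orbT.
have T0 : 0 < T by lra.
have b0 := le_trans a0 ab.
have [ak bk wa wb] : [/\ a <= a + k, b <= b + k,
    a + k + k <= a + d1 & b + k + k <= b + d2] by split; lra.
have [ak0 akb waT bkkT] : [/\ 0 < a + k, a + k <= b + k,
    a + k + k <= T & b + k + k < T] by split; lra.
have wbT := ltW bkkT; have bk0 := le_trans b0 bk.
have [iF FL] := HL (a + k) (b + k) k ak0 akb k0 bkkT.
pose f := plateau S (a + k) (b + k) k.
have slice t : `]0, T[%classic t -> (leb R).-integrable `]0%R, +oo[
    (fun x => (derive1 f t * (H t x * g x))%:E).
  rewrite /= in_itv/= => /andP[t0 _].
  exact: (integrableZl _ (derive1 f t) (iH t (ltW t0))).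
have [iT FE] := Rintegral_fubini (g := fun p => derive1 f p.1 * (H p.1 p.2 * g p.2))
  (measurable_itv _) (measurable_itv _) iF slice.
have mE t : `]0, T[%classic t ->
    \int[leb R]_(x in `]0, +oo[) (derive1 f t * (H t x * g x)) = derive1 f t * m t.
  rewrite /= in_itv/= => /andP[t0 _].
  by rewrite RintegralZl//; exact: iH (ltW t0).
pose c1 := m a - e / 2; pose c2 := m b + e / 2.
(* F' is a lower bound for f' m, because m >= c1 under the positive kernel and m <= c2 under the
   negative one. Its integral over (0, T) is exactly c1 - c2. *)
pose F t := stept S (a + k) k t * c1 - stept S (b + k) k t * c2.
have sF : smooth F.
  by apply: smoothB; apply: smoothM; do ?[exact: smooth_stept|exact: smooth_cst].
have F'E t : derive1 F t = kern S (a + k) k t * c1 - kern S (b + k) k t * c2.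
  have h1 := derive1Zl c1 t (smooth_stept S (a + k) k).
  have h2 := derive1Zl c2 t (smooth_stept S (b + k) k).
  by rewrite (derive1_val (is_deriveB h1 h2)) !derive1_stept.
have low (t : R) : t < T -> derive1 F t <= derive1 f t * m t.
  move=> tT; rewrite F'E derive1_plateau mulrBl.
  apply: lerB.
    have [/andP[h1 h2]|h] := boolP (a + k < t < a + k + k); last first.
      by rewrite kern_supp// !mul0r.
    rewrite ler_wpM2l ?kern_ge0//.
    have : `|m t - m a| <= e / 2.
      apply: Hd1; [exact: le_trans ak (ltW h1)| |exact: ltW].
      exact: le_trans (ltW h2) wa.
    by rewrite ler_distl => /andP[].
  have [/andP[h1 h2]|h] := boolP (b + k < t < b + k + k); last first.
    by rewrite kern_supp// !mul0r.
  rewrite ler_wpM2l ?kern_ge0//.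
  have : `|m t - m b| <= e / 2.
    apply: Hd2; [exact: le_trans bk (ltW h1)| |exact: ltW].
    exact: le_trans (ltW h2) wb.
  by rewrite ler_distl => /andP[].
have : F T - F 0 <= L.
  apply: le_trans FL; rewrite FE -Rintegral_derive1//.
  apply: le_Rintegral => //.
    by apply: continuous_Rintegrable; exact/smooth_continuous/smooth_derive1.
  by move=> t tT; rewrite mE//; apply: low; move: tT; rewrite /= in_itv/= => /andP[].
have -> : F T = c1 - c2 by rewrite /F !stept1 ?mul1r.
have -> : F 0 = 0 by rewrite /F !(@stept0 _ S k k0) ?mul0r ?subrr// ltW.
by rewrite subr0; exact: le_of_half_gaps.
Qed.

(** The factor 2 is a Lipschitz constant of m - |m - v| in m. The lemma is used for H = n - |n - V|
    and for H = n. *)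
Lemma slice_continuous (n H : R -> R -> R) (g : R -> R) (T : R) :
  (forall t, 0 <= t -> (leb R).-integrable `]0%R, +oo[ (fun x => (n t x)%:E)) ->
  (forall t, t \in `[0, T] ->
        (\int[leb R]_(x in `]0%R, +oo[) `|n s x - n t x|%:E)%E
          @[s --> within `[0, T] (nbhs t)] --> 0%E) ->
  (forall s t x, `|H s x - H t x| <= 2 * `|n s x - n t x|) ->
  (forall x, 0 <= g x <= 1) ->
  (forall t, 0 <= t -> (leb R).-integrable `]0%R, +oo[ (fun x => (H t x * g x)%:E)) ->
  let m t := \int[leb R]_(x in `]0, +oo[) (H t x * g x) in
  forall t e, 0 <= t -> t < T -> 0 < e ->
    exists2 d, 0 < d & forall s, t <= s -> s <= t + d -> s <= T -> `|m s - m t| <= e.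
Proof.
move=> iN cN lip g01 iH m t e t0 tT e0.
have e2 : (0 < (e / 2)%:E)%E by rewrite lte_fin divr_gt0.
have tin : t \in `[0, T] by rewrite in_itv/= t0 ltW.
have := cN t tin _ (open_ereal_lt' e2).
rewrite /nbhs/= /within/= => -[d /= d0 Hd].
exists (d / 2); first by rewrite divr_gt0.
move=> s ts sd sT; have s0 := le_trans t0 ts.
have {}Hd : (\int[leb R]_(x in `]0%R, +oo[) `|n s x - n t x|%:E < (e / 2)%:E)%E.
  apply: Hd; last by rewrite /= in_itv/= s0.
  by rewrite /ball/= ler0_norm ?subr_le0//; lra.
have i1 : (leb R).-integrable `]0%R, +oo[ (fun x => (n s x - n t x)%:E).
  by apply: eq_integrable (integrableB _ (iN s s0) (iN t t0)).
have i2 : (leb R).-integrable `]0%R, +oo[ (fun x => (H s x * g x - H t x * g x)%:E).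
  by apply: eq_integrable (integrableB _ (iH s s0) (iH t t0)).
rewrite /m -RintegralB//; [|exact: iH|exact: iH].
apply: le_trans (le_normr_Rintegral _ i2) _ => //.
have i3 := integrable_norm i1.
apply: (@le_trans _ _ (\int[leb R]_(x in `]0, +oo[) (2 * `|n s x - n t x|))).
  apply: le_Rintegral => //.
  - exact: (integrable_norm i2).
  - exact: (integrableZl _ 2 i3).
  move=> x _; rewrite -mulrBl normrM.
  have /andP[gx0 gx1] := g01 x; rewrite (ger0_norm gx0).
  by rewrite -[leRHS]mulr1 ler_pM.
rewrite RintegralZl//.
have : fine (\int[leb R]_(x in `]0%R, +oo[) `|n s x - n t x|%:E)%E <= e / 2.
  rewrite -lee_fin fineK; first exact: ltW.
  exact: integrable_fin_num i3.
by rewrite /Rintegral; lra.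
Qed.

End evolution.

(** * Fluxes through the ends of a window *)

Section elementary.
Context {R : realType}.

(** The expression is twice the flux of min(m, v): it is 2 m (v - m) for m <= v and 0 otherwise. The
    bound is its maximum, at m = v / 2. *)
Lemma upwind_bounds (m v : R) : 0 <= m -> 0 <= v ->
  0 <= m * (v - m) + `|m - v| * m <= v ^+ 2 / 2.
Proof.
move=> m0 v0; have [mv|vm] := leP m v.
  rewrite ler0_norm ?subr_le0//; have := sqr_ge0 (v - 2 * m).
  have : 0 <= m * (v - m) by rewrite mulr_ge0 ?subr_ge0.
  by rewrite !expr2; lra.
rewrite gtr0_norm ?subr_gt0// (_ : _ + _ = 0); last by ring.
by rewrite lexx divr_ge0 ?sqr_ge0.
Qed.

Lemma V_le_right (k x : R) : 0 <= k -> 2 - k <= x <= 2 -> V x <= 2 * k.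
Proof.
move=> k0 /andP[kx x2]; have : 0 <= 2 * (x - (2 - k)) by rewrite mulr_ge0 ?subr_ge0.
by have := sqr_ge0 (2 - x); rewrite /V !expr2; lra.
Qed.

Lemma V_le0 (x : R) : 2 <= x -> V x <= 0.
Proof.
move=> x2; have : 0 <= x * (x - 2) by rewrite mulr_ge0 ?subr_ge0// (le_trans _ x2).
by rewrite /V expr2; lra.
Qed.

Lemma upwind_right (k x m : R) : 0 <= k -> 0 <= V x -> 2 - k < x < 2 - k + k ->
  0 <= m -> m * (V x - m) + `|m - V x| * m <= 2 * k * k.
Proof.
move=> k0 v0 /andP[kx x2] m0; have /andP[_] := upwind_bounds m0 v0.
have Vx : V x <= 2 * k by apply: V_le_right => //; apply/andP; split; lra.
by have := ler_pM v0 v0 Vx Vx; rewrite expr2; lra.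
Qed.

Lemma abs_minus_le (m v : R) : 0 <= v <= 1 ->
  `|m - `|m - v| | <= 2 * (1 + m ^+ 2).
Proof.
move=> /andP[v0 v1]; apply: le_trans (ler_normB _ _) _; rewrite normr_id.
apply: le_trans (lerD (lexx _) (ler_normB _ _)) _; rewrite (ger0_norm v0).
rewrite -(real_normK (num_real m)); move: (sqr_ge0 (`|m| - 1)) (sqr_ge0 `|m|).
by rewrite !expr2; lra.
Qed.

End elementary.

Section fluxes.
Context {R : realType} (S : smooth_step R).
Variables (T : R) (n : R -> R -> R).
Hypothesis sol : entropy_solution_on T n.
Hypothesis pos : forall t, 0 <= t -> {ae leb R, forall x, 0 < x -> 0 <= n t x}.

Local Notation M2 := (measurableTypeR R * measurableTypeR R)%type.
Local Notation D := (`]0%R, T[ `*` `]0%R, +oo[ : set M2).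
Local Notation rect a b c d := (`[a, b]%classic `*` `[c, d]%classic : set M2).

Lemma derive1_step_bounded : exists2 M, 0 <= M & forall x, derive1 S x <= M.
Proof.
have [M M0 HM] := segment_bounded 0 1
  (smooth_continuous (smooth_derive1 (step_smooth S))).
exists M => // x; have [x0|x0] := leP x 0; first by rewrite derive1_step0.
have [x1|x1] := leP 1 x; first by rewrite derive1_step1.
by apply: le_trans (ler_norm _) _; apply: HM; rewrite !ltW.
Qed.

Lemma weighted_integrable (h : R -> R -> R) (f g : R -> R) (a b c d : R) :
  smooth f -> smooth g -> 0 < a -> a <= b -> b < T -> 0 < c -> c <= d ->
  supported f a b -> supported g c d ->
  measurable_fun D (fun p : M2 => h p.1 p.2) ->
  (forall p : M2, rect a b c d p -> `|h p.1 p.2| <= 2 * (1 + n p.1 p.2 ^+ 2)) ->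
  (leb2 R).-integrable D (fun p => (f p.1 * (h p.1 p.2 * g p.2))%:E).
Proof.
move=> sf sg a0 ab bT c0 cd fab gcd mh hn.
have [M1 M10 H1] := segment_bounded a b (smooth_continuous sf).
have [M3 M30 H3] := segment_bounded c d (smooth_continuous sg).
apply: (dominated_integrable (a := a) (b := b) (c := c) (d := d)
   (q := fun p => (M1 * 2 * M3) * (1 + n p.1 p.2 ^+ 2))) => //.
- have m1 := @measurable_t _ T _ sf; have m2 := @measurable_x _ T _ sg; by meas.
- exact: (bound_integrable sol S).
- move=> p rp; have [/=] := rp; rewrite !in_itv/= => pt px.
  have := ler_pM (normr_ge0 _) (normr_ge0 _) (hn p rp) (H3 _ px).
  move/(ler_pM (normr_ge0 _) (mulr_ge0 (normr_ge0 _) (normr_ge0 _)) (H1 _ pt)).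
  by rewrite !normrM; lra.
- move=> p _ nrp; by rewrite mulrCA (off_rectangle fab gcd nrp) mulr0.
Qed.

(** Here H = 2 min(n, V) - V. The equation minus the profile inequality is X + Y, with X the time
    part and Y the flux part, and has integral at most 0; an upper bound for X is thus a lower bound
    for Y. In Y the left end of the cut-off contributes with a good sign, the right end is small. *)
Lemma min_evolution : exists2 C, 0 <= C & forall delta a b e,
  0 < delta -> 2 * delta <= 1 -> 0 < a -> a <= b -> 0 < e -> b + e < T ->
  let H t x := n t x - `|n t x - V x| in
  let X (p : M2) := derive1 (plateau S a b e) p.1
    * (H p.1 p.2 * plateau S delta (2 - delta) delta p.2) in
  (leb2 R).-integrable D (EFin \o X) /\
  \int[leb2 R]_(p in D) X p <= C * T * delta.
Proof.
have [M M0 HM] := derive1_step_bounded.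
(* At the right end the flux is at most 2 delta^2 and the slope of the cut-off at most M / delta, so
   the loss is at most 2 M delta pointwise; the rectangle has area at most 2 T. *)
exists (4 * M) => [|k a b e k0 k1 a0 ab e0 beT H X]; first exact: mulr_ge0.
set f := plateau S a b e in X *; set g := plateau S k (2 - k) k in X *.
have kk : k <= 2 - k by lra.
have k2 : k <= 2 by lra.
have abe : a <= b + e by lra.
have abe' : a < b + e by lra.
have k2' : k < 2 by lra.
have T0 : 0 < T by lra.
have [le1 le2] : b + e - a <= T /\ 2 - k <= 2 by split; lra.
have [ge1 ge2] : 0 <= b + e - a /\ 0 <= 2 - k by split; lra.
have sf : smooth f by exact: smooth_plateau.
have sg : smooth g by exact: smooth_plateau.
have f0 t : 0 <= f t by exact: plateau_ge0.
have g0 x : 0 <= g x by exact: plateau_ge0.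
have fs : supported f a (b + e) by exact: plateau_supp.
have gs : supported g k 2 by have := plateau_supp S k0 kk; rewrite subrK.
have fs' := supported_derive1 sf f0 fs; have gs' := supported_derive1 sg g0 gs.
have [iK K0] := kruzhkov_profile sol S sf sg f0 g0 a0 abe beT k0 k2 fs gs.
have [iW W0] := test_weak sol sf sg a0 beT k0 fs gs.
have V01 x : k <= x <= 2 -> 0 <= V x <= 1.
  by move=> /andP[kx x2]; apply: V_bounds; rewrite x2 (le_trans (ltW k0)).
have iX : (leb2 R).-integrable D (EFin \o X).
  apply: (weighted_integrable (h := H) _ _ a0 abe beT k0 k2 fs' gs) => //.
  - exact: smooth_derive1.
  - have mn := measurable_sol sol; have mV := @measurable_x _ T _ (@smooth_V R).
    have mw : measurable_fun D (fun p : M2 => `|n p.1 p.2 - V p.2|).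
      by apply: measurableT_comp => //; exact: measurable_funB.
    by rewrite /H; meas.
  - by move=> p [_] /=; rewrite in_itv/= => /V01 v01; exact: abs_minus_le.
pose Q (p : M2) : R := n p.1 p.2 * (V p.2 - n p.1 p.2)
  + `|n p.1 p.2 - V p.2| * n p.1 p.2.
pose Y (p : M2) : R := Q p * (f p.1 * derive1 g p.2).
have XYE (p : M2) : X p + Y p = (n p.1 p.2 * (derive1 f p.1 * g p.2)
     + n p.1 p.2 * (V p.2 - n p.1 p.2) * (f p.1 * derive1 g p.2)) -
   (`|n p.1 p.2 - V p.2| * (derive1 f p.1 * g p.2)
  - `|n p.1 p.2 - V p.2| * n p.1 p.2 * (f p.1 * derive1 g p.2)).
  by rewrite /X /Y /Q /H; ring.
have iXY : (leb2 R).-integrable D (fun p => (X p + Y p)%:E).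
  apply: eq_integrable (integrableB (measurable_D T) iW iK) => // p _ /=.
  by rewrite XYE EFinB.
have XY0 : \int[leb2 R]_(p in D) (X p + Y p) <= 0.
  rewrite (eq_Rintegral _ (fun p _ => XYE p)) RintegralB// W0 sub0r.
  by rewrite oppr_le0.
have iY : (leb2 R).-integrable D (EFin \o Y).
  apply: eq_integrable (integrableB (measurable_D T) iXY iX) => // p _ /=.
  by rewrite -EFinB addrAC subrr add0r.
pose rc : set M2 := rect a (b + e) k 2.
have mrc : measurable rc by exact: measurable_rect.
have fin : (leb2 R (D `&` rc) < +oo)%E.
  apply: le_lt_trans (rect_fin a (b + e)%R k 2).
  by apply: le_measure; rewrite ?inE//; exact: measurableI.
(* Adding the pointwise bound of the loss on the rectangle makes the integrand non-negative for
   every t and almost every x. *)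
pose Z (p : M2) : R := Y p + 2 * M * k * \1_rc p.
have iI : (leb2 R).-integrable D (fun p : M2 => (\1_rc p)%:E).
  apply/integrableP; split; first exact/measurable_EFinP/measurable_indic.
  under eq_integral do rewrite gee0_abs ?lee_fin//.
  by rewrite (integral_indic _ (measurable_D T) mrc) setIC.
have iC : (leb2 R).-integrable D (fun p : M2 =>
    (2 * M * k * \1_rc p)%:E).
  exact: (integrableZl (measurable_D T) (2 * M * k) iI).
have iZ : (leb2 R).-integrable D (EFin \o Z).
  by apply: eq_integrable (integrableD (measurable_D T) iY iC) => // p _ /=.
have Z0 : 0 <= \int[leb2 R]_(p in D) Z p.
  apply: slices_Rintegral_ge0 => //.
    by have /measurable_int/measurable_EFinP := iZ.
  move=> t; rewrite /= in_itv/= => /andP[t0 tT].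
  apply: ae_lebS (pos (ltW t0)) => x nx; rewrite in_itv/= andbT => x0.
  have {}nx := nx x0.
  have [rp|nrp] := pselect (rc (t, x)); last first.
    by rewrite /Z /Y (off_rectangle fs gs' nrp) mulr0 indicE memNset// mulr0 addr0.
  have [/= _] := rp; rewrite in_itv/= => kx2; have /andP[v0 v1] := V01 x kx2.
  rewrite /Z /Y /Q indicE mem_set// mulr1 /=.
  set m := n t x in nx *.
  set q := _ + _ * m; rewrite derive1_plateau.
  have /andP[q0 q1] := upwind_bounds nx v0.
  have k0' : 0 <= kern S k k x by exact: kern_ge0.
  have ft1 : f t <= 1 by exact: plateau_le1.
  have B1 : q * kern S (2 - k) k x <= 2 * M * k.
    have [/andP[h1 h2]|h] := boolP (2 - k < x < 2 - k + k); last first.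
      by rewrite kern_supp// mulr0 !mulr_ge0// ltW.
    have q2 : q <= 2 * k * k by apply: upwind_right => //; [exact: ltW|exact/andP].
    have kM : kern S (2 - k) k x <= M / k by rewrite ler_pM2r ?invr_gt0.
    apply: le_trans (ler_pM q0 (kern_ge0 S k0 _ _) q2 kM) _.
    by rewrite (_ : 2 * k * k * (M / k) = 2 * M * k)//; field; rewrite gt_eqF.
  have B2 : f t * (q * kern S (2 - k) k x) <= 2 * M * k.
    apply: le_trans (_ : 1 * (q * kern S (2 - k) k x) <= _); last by rewrite mul1r.
    by apply: ler_wpM2r => //; rewrite mulr_ge0// kern_ge0.
  rewrite (_ : _ + _ = q * (f t * kern S k k x)
    + (2 * M * k - f t * (q * kern S (2 - k) k x))); last by ring.
  by rewrite addr_ge0 ?subr_ge0// mulr_ge0// mulr_ge0.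
split => //.
have YE : \int[leb2 R]_(p in D) Y p =
    \int[leb2 R]_(p in D) Z p - 2 * M * k * fine (leb2 R rc).
  rewrite [in RHS]/Z RintegralD// RintegralZl//.
  rewrite [X in _ = _ + _ * X - _]/Rintegral integral_indic//.
  rewrite (_ : _ `&` D = rc) ?addrK//.
  by apply: setIidl; exact: rect_D.
have XE : \int[leb2 R]_(p in D) X p + \int[leb2 R]_(p in D) Y p <= 0.
  by rewrite -RintegralD.
have mu : fine (leb2 R rc) <= 2 * T.
  rewrite (product_measure1E (leb R) (leb R))//= !lebesgue_measure_itv/= !lte_fin.
  rewrite abe' k2'.
  by rewrite -!EFinB -EFinM /= mulrC ler_pM.
move: XE Z0 (ler_wpM2l (mulr_ge0 M0 (ltW k0)) mu); rewrite YE.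
move: (fine _) (Rintegral _ _ X) (Rintegral _ _ Z) => r x z; clear; lra.
Qed.

End fluxes.

(** * Mass in a window beyond x = 2 *)

Section mass.
Context {R : realType} (S : smooth_step R).
Variables (T : R) (n : R -> R -> R).
Hypothesis sol : entropy_solution_on T n.
Hypothesis pos : forall t, 0 <= t -> {ae leb R, forall x, 0 < x -> 0 <= n t x}.

Local Notation M2 := (measurableTypeR R * measurableTypeR R)%type.
Local Notation D := (`]0%R, T[ `*` `]0%R, +oo[ : set M2).
Local Notation rect a b c d := (`[a, b]%classic `*` `[c, d]%classic : set M2).

(** The cut-off rises on (1, 2), where n vanishes, and falls beyond r >= 2, where V <= 0 makes the
    flux n (V - n) nonpositive. Both facts give the flux term a sign, so there is no error term. *)
Lemma mass_evolution (r a b e : R) :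
  (forall t, 0 <= t -> {ae leb R, forall x, 0 < x < 2 -> n t x = 0}) ->
  2 <= r -> 0 < a -> a <= b -> 0 < e -> b + e < T ->
  let X (p : M2) := derive1 (plateau S a b e) p.1
    * (n p.1 p.2 * plateau S 1 r 1 p.2) in
  (leb2 R).-integrable D (EFin \o X) /\ \int[leb2 R]_(p in D) X p <= 0.
Proof.
move=> n0 r2 a0 ab e0 beT X.
set f := plateau S a b e in X *; set g := plateau S 1 r 1 in X *.
have r1 : 1 <= r by lra.
have r11 : 1 <= r + 1 by lra.
have abe : a <= b + e by lra.
have sf : smooth f by exact: smooth_plateau.
have sg : smooth g by exact: smooth_plateau.
have f0 t : 0 <= f t by exact: plateau_ge0.
have g0 x : 0 <= g x by exact: plateau_ge0.
have fs : supported f a (b + e) by exact: plateau_supp.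
have gs : supported g 1 (r + 1) by exact: plateau_supp.
have fs' := supported_derive1 sf f0 fs; have gs' := supported_derive1 sg g0 gs.
have [iW W0] := test_weak sol sf sg a0 beT ltr01 fs gs.
have iX : (leb2 R).-integrable D (EFin \o X).
  apply: (weighted_integrable S sol (h := n) _ _ a0 abe beT ltr01 r11 fs' gs) => //.
  - exact: smooth_derive1.
  - exact: measurable_sol.
  - move=> p _; set m := n _ _; rewrite -(real_normK (num_real m)).
    by move: (sqr_ge0 (`|m| - 1)) (sqr_ge0 `|m|); rewrite !expr2; lra.
pose Y (p : M2) : R := n p.1 p.2 * (V p.2 - n p.1 p.2) * (f p.1 * derive1 g p.2).
have XYE (p : M2) : n p.1 p.2 * (derive1 f p.1 * g p.2)
     + n p.1 p.2 * (V p.2 - n p.1 p.2) * (f p.1 * derive1 g p.2) = X p + Y p.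
  by rewrite /X /Y; ring.
have XY0 : \int[leb2 R]_(p in D) (X p + Y p) = 0.
  by have := W0; rewrite (eq_Rintegral _ (fun p _ => XYE p)).
have iY : (leb2 R).-integrable D (EFin \o Y).
  apply: eq_integrable (integrableB (measurable_D T) iW iX) => // p _ /=.
  by rewrite -EFinB XYE addrAC subrr add0r.
have Y0 : 0 <= \int[leb2 R]_(p in D) Y p.
  apply: slices_Rintegral_ge0 => //.
    by have /measurable_int/measurable_EFinP := iY.
  move=> t; rewrite /= in_itv/= => /andP[t0 tT].
  apply: ae_lebS2 (pos (ltW t0)) (n0 t (ltW t0)) => x nx nx0.
  rewrite in_itv/= andbT => x0; have {}nx := nx x0; rewrite /Y /=.
  have [x2|x2] := ltP x 2; first by rewrite nx0 ?x0// !mul0r.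
  have -> : derive1 g x = - kern S r 1 x.
    rewrite derive1_plateau (@kern_supp _ S 1 ltr01 1 x) ?sub0r//.
    by rewrite negb_and -!leNgt; apply/orP; right; lra.
  have V0 := V_le0 x2.
  rewrite mulrN mulrN -mulNr -mulrN opprB; apply: mulr_ge0.
    by rewrite mulr_ge0// subr_ge0 (le_trans V0).
  by rewrite mulr_ge0// kern_ge0.
split => //; move: XY0; rewrite RintegralD// => XY0.
move: XY0 Y0; move: (Rintegral _ _ X) (Rintegral _ _ Y) => x y.
by move=> /eqP; rewrite addr_eq0 => /eqP ->; rewrite oppr_le0.
Qed.

End mass.

(** * Null functions and the steady profiles *)

Section null_functions.
Context {R : realType}.

Lemma Rintegral_le0_ae (B : set R) (f : R -> R) : measurable B ->
  (leb R).-integrable B (fun x => (f x)%:E) ->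
  {ae leb R, forall x, B x -> 0 <= f x} ->
  \int[leb R]_(x in B) f x <= 0 ->
  {ae leb R, forall x, B x -> f x = 0}.
Proof.
move=> mB0 iF f0 If.
have mB : measurable (B : set (measurableTypeR R)) by [].
have mf := measurable_int _ iF.
have E : (\int[leb R]_(x in B) `|(f x)%:E| = \int[leb R]_(x in B) (f x)%:E)%E.
  apply: ae_eq_integral => //; first exact: measurableT_comp.
  by apply: ae_lebS f0 => x h Bx; rewrite gee0_abs// lee_fin h.
have If0 : (\int[leb R]_(x in B) `|(f x)%:E| = 0)%E.
  apply/eqP; rewrite eq_le integral_ge0// andbT E.
  by rewrite -(fineK (integrable_fin_num mB iF)) lee_fin.
have /(ae_eq_integral_abs (leb R) mB mf) := If0.
by apply: ae_lebS => x h Bx; have [] := h Bx.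
Qed.

Lemma nhatE (beta x : R) : nhat beta x = V x * \1_(`]beta, 2[) x.
Proof. by rewrite indicE mem_setE/= in_itv/= /nhat; case: ifP; rewrite ?mulr1 ?mulr0. Qed.

Lemma nhat_ge0 (beta x : R) : 0 <= beta -> 0 <= nhat beta x.
Proof.
move=> b0; rewrite /nhat; case: ifP => // /andP[bx x2].
by have /andP[] : 0 <= V x <= 1 by apply: V_bounds; lra.
Qed.

Lemma measurable_V : measurable_fun setT (V : R -> R).
Proof. by apply: continuous_measurable_fun; apply: smooth_continuous; exact: smooth_V. Qed.

Lemma nhat_integrable (beta : R) : 0 <= beta ->
  (leb R).-integrable setT (fun x => (nhat beta x)%:E).
Proof.
move=> b0; apply: le_integrable (integrable_indic_itv 0 2 true false) => //.
  apply/measurable_EFinP; rewrite (funext (nhatE beta)).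
  by apply: measurable_funM; [exact: measurable_V|exact: measurable_indic].
move=> x _; rewrite /= lee_fin nhatE !indicE !mem_setE/= !in_itv/=.
have [/andP[bx x2]|_] := boolP (beta < x < 2); last by rewrite mulr0 normr0.
have x02 : 0 <= x <= 2 by lra.
have /andP[v0 v1] := V_bounds x02.
by rewrite x02 mulr1 normr1 ger0_norm.
Qed.

End null_functions.

(** * Long times *)

Section longtime.
Context {R : realType} (S : smooth_step R).
Variables (n : R -> R -> R) (alpha : R).
Hypothesis sol : entropy_solution n.
Hypothesis pos : forall t, 0 <= t -> {ae leb R, forall x, 0 < x -> 0 <= n t x}.
Hypothesis iN : forall t, 0 <= t -> (leb R).-integrable `]0, +oo[ (fun x => (n t x)%:E).
Hypothesis cN : forall T, 0 < T -> forall t, t \in `[0, T] ->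
  (\int[leb R]_(x in `]0%R, +oo[) `|n s x - n t x|%:E)%E
    @[s --> within `[0, T] (nbhs t)] --> 0%E.
Hypothesis alpha0 : 0 <= alpha.
Hypothesis lim : (\int[leb R]_(x in `[0%R, +oo[) `|n t x - nhat alpha x|%:E)%E
  @[t --> +oo] --> 0%E.

Local Notation half := (`]0%R, +oo[%classic : set (measurableTypeR R)).

Let mN t : 0 <= t -> measurable_fun half (n t).
Proof. by move=> /iN/measurable_int/measurable_EFinP. Qed.

Lemma dominated_half (f u : R -> R) : measurable_fun half f ->
  (leb R).-integrable half (EFin \o u) ->
  (forall x, 0 < x -> `|f x| <= `|u x| + \1_(`[0%R, 2%R]) x) ->
  (leb R).-integrable half (EFin \o f).
Proof.
move=> mf iu fu.
have i1 : (leb R).-integrable half (fun x => (\1_(`[0%R, 2%R]) x)%:E).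
  exact: integrableS (integrable_indic_itv 0 2 true false).
have iu' := integrable_norm iu.
apply: le_integrable (integrableD _ iu' i1) => //; first exact/measurable_EFinP.
move=> x /=; rewrite in_itv/= andbT => x0; rewrite lee_fin.
by apply: le_trans (fu x x0) _; exact: ler_norm.
Qed.

(** For small k > 0 the cut-off lives in [k, 2], where V coincides with [nhat 0]; so the polynomial
    V can replace the truncated profile. *)
Definition min_mass (k t : R) : R :=
  \int[leb R]_(x in `]0, +oo[) (Num.min (n t x) (V x) * plateau S k (2 - k) k x).

Section window.
Variable k : R.
Hypotheses (k0 : 0 < k) (k1 : 2 * k <= 1).
Let g := plateau S k (2 - k) k.

Let kk : k <= 2 - k. Proof. by have := k1; lra. Qed.
Let sg : smooth g. Proof. exact: smooth_plateau. Qed.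
Let g0 x : 0 <= g x. Proof. exact: plateau_ge0. Qed.
Let g1 x : g x <= 1. Proof. exact: plateau_le1. Qed.

Let gs : supported g k 2.
Proof. by have := plateau_supp S k0 kk; rewrite subrK. Qed.

Let mg : measurable_fun half g.
Proof.
by apply: measurable_funTS; apply: continuous_measurable_fun; exact: smooth_continuous.
Qed.

Let mV : measurable_fun half (V : R -> R).
Proof. by apply: measurable_funTS; exact: measurable_V. Qed.

Let V01 x : k <= x <= 2 -> 0 <= V x <= 1.
Proof. by move=> kx2; apply: V_bounds; have := k0; lra. Qed.

Lemma min_g_integrable t : 0 <= t -> (leb R).-integrable half
  (EFin \o (fun x => Num.min (n t x) (V x) * g x)).
Proof.
move=> t0; apply: (dominated_half (u := n t)).
- by apply: measurable_funM => //; apply: measurable_minr => //; exact: mN.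
- exact: iN.
move=> x x0; have [kx2|nkx] := boolP (k <= x <= 2); last first.
  by rewrite gs// mulr0 normr0 addr_ge0.
have /andP[v0 v1] := V01 kx2; have /andP[_ x2] := kx2.
rewrite indicE mem_set /=; last by rewrite in_itv/= ltW.
rewrite normrM (ger0_norm (g0 x)) -[leRHS]mulr1; apply: ler_pM => //.
rewrite /Num.min; case: ifP => _; first by rewrite lerDl.
by rewrite ger0_norm// ler_wpDl.
Qed.

Lemma V_g_integrable : (leb R).-integrable half (EFin \o (fun x => V x * g x)).
Proof.
apply: (dominated_half (u := cst 0)).
- exact: measurable_funM.
- exact: integrable0.
move=> x x0; have [kx2|nkx] := boolP (k <= x <= 2); last first.
  by rewrite gs// mulr0 normr0 addr_ge0.
have /andP[v0 v1] := V01 kx2; have /andP[_ x2] := kx2.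
rewrite indicE mem_set /=; last by rewrite in_itv/= ltW.
by rewrite normr0 add0r normrM !ger0_norm// -[leRHS]mulr1 ler_pM.
Qed.

(** Pointwise min(n, V) <= n <= [nhat alpha] + |n - [nhat alpha]|, and the cut-off is at most 1. *)
Lemma min_mass_le_limit t : 0 <= t -> min_mass k t <=
  \int[leb R]_(x in `]0, +oo[) nhat alpha x
  + \int[leb R]_(x in `]0, +oo[) `|n t x - nhat alpha x|.
Proof.
move=> t0; have ih := @integrableS _ _ _ (leb R) setT half _ measurableT
  (measurable_itv _) (@subsetT _ _) (nhat_integrable alpha0).
have id : (leb R).-integrable half (fun x => (n t x - nhat alpha x)%:E).
  by apply: eq_integrable (integrableB _ (iN t0) ih).
have id' := integrable_norm id.
rewrite -RintegralD//; apply: le_Rintegral => //.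
- exact: min_g_integrable.
- by apply: eq_integrable (integrableD _ ih id').
move=> x _; have h0 := nhat_ge0 x alpha0.
have d0 := ler_norm (n t x - nhat alpha x).
have r0 : 0 <= nhat alpha x + `|n t x - nhat alpha x| by exact: addr_ge0.
apply: (@le_trans _ _ ((nhat alpha x + `|n t x - nhat alpha x|) * g x)).
  by apply: ler_wpM2r => //; rewrite ge_min; apply/orP; left; lra.
by rewrite -[leRHS]mulr1 ler_wpM2l.
Qed.

Lemma minimum_integrable t : 0 <= t ->
  (leb R).-integrable (`]0%R, 2%R[%classic : set (measurableTypeR R))
    (fun x => (Num.min (n t x) (nhat 0 x))%:E).
Proof.
move=> t0; have sub : `]0%R, 2%R[%classic `<=` half.
  by move=> x /=; rewrite !in_itv/= andbT => /andP[].
have ih : (leb R).-integrable setT (fun x => (nhat 0 x)%:E) by exact: nhat_integrable.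
have m02 : measurable (`]0%R, 2%R[%classic : set (measurableTypeR R)) by [].
have mh : measurable half by [].
have i1 := integrable_norm (integrableS mh m02 sub (iN t0)).
have i2 := integrable_norm (integrableS measurableT m02 (@subsetT _ _) ih).
apply: le_integrable (integrableD m02 i1 i2) => //.
  apply/measurable_EFinP; apply: measurable_minr.
    by apply: measurable_funS (mN t0).
  by have /measurable_int/measurable_EFinP := ih; apply: measurable_funTS.
move=> x _ /=; rewrite lee_fin; apply: le_trans (ler_norm _).
by rewrite /Num.min; case: ifP => _; rewrite ?lerDl ?lerDr.
Qed.

(** On (0, 2) the cut-off differs from 1 only in (0, 2k] and [2 - k, 2), of total length 3k, and
    there the minimum is at most V <= 1. *)
Lemma minimum_le_min_mass t : 0 <= t ->
  \int[leb R]_(x in (`]0%R, 2%R[%classic : set (measurableTypeR R)))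
    Num.min (n t x) (nhat 0 x) <= min_mass k t + 3 * k.
Proof.
move=> t0; pose A : set (measurableTypeR R) := `]0%R, 2 * k]%classic.
pose B : set (measurableTypeR R) := `[2 - k, 2%R]%classic.
have mA : measurable A by exact: measurable_itv.
have mB : measurable B by exact: measurable_itv.
have iA : (leb R).-integrable half (fun x => (\1_A x)%:E).
  exact: integrableS (integrable_indic_itv 0 (2 * k) false false).
have iB : (leb R).-integrable half (fun x => (\1_B x)%:E).
  exact: integrableS (integrable_indic_itv (2 - k) 2 true false).
have lA : \int[leb R]_(x in `]0, +oo[) \1_A x <= 2 * k.
  rewrite /Rintegral integral_indic//.
  have -> : A `&` half = A.
    by apply: setIidl => x /=; rewrite !in_itv/= andbT => /andP[].
  rewrite /= lebesgue_measure_itv/= lte_fin ifT ?mulr_gt0//.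
  by rewrite -EFinB subr0.
have lB : \int[leb R]_(x in `]0, +oo[) \1_B x <= k.
  rewrite /Rintegral integral_indic//.
  have -> : B `&` half = B.
    apply: setIidl => x /=; rewrite !in_itv/= andbT => /andP[h _].
    rewrite bnd_simp in h; apply: (lt_le_trans _ (h : (2 - k <= x :> R))).
    by have := k1; have := k0; lra.
  rewrite /= lebesgue_measure_itv/= lte_fin ifT; last by rewrite gtrBl.
  by rewrite -EFinB /=; lra.
have sub : (`]0%R, 2%R[%classic : set (measurableTypeR R)) `<=` half.
  by move=> x /=; rewrite !in_itv/= andbT => /andP[].
have E : (`]0%R, 2%R[%classic : set (measurableTypeR R)) = half `&` `]0%R, 2%R[%classic.
  by apply/esym/setIidr.
rewrite E Rintegral_mkcondr.
have iM := min_g_integrable t0.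
have iAB : (leb R).-integrable half (fun x => (\1_A x + \1_B x)%:E).
  by apply: eq_integrable (integrableD _ iA iB).
apply: (@le_trans _ _ (\int[leb R]_(x in `]0, +oo[)
   (Num.min (n t x) (V x) * g x + (\1_A x + \1_B x)))); last first.
  rewrite RintegralD// RintegralD// /min_mass -/g.
  by move: (Rintegral _ _ _) lA lB => y; lra.
apply: le_Rintegral => //.
- rewrite -restrict_EFin; apply: (iffLR (integrable_restrict _ _ _ _)) => //.
  by rewrite -E; exact: minimum_integrable.
- by apply: eq_integrable (integrableD _ iM iAB).
move=> x _; rewrite patchE mem_setE; case: ifP => [|x2].
  rewrite in_itv/= => /andP[x0 x2].
  have -> : nhat 0 x = V x by rewrite /nhat x0 x2.
  set q := Num.min _ _.
  have q1 : q <= 1.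
    have /andP[_ v1] : 0 <= V x <= 1 by apply: V_bounds; rewrite !ltW.
    by rewrite ge_min v1 orbT.
  have qg : q <= q * g x + (1 - g x).
    have : 0 <= (1 - q) * (1 - g x) by rewrite mulr_ge0 ?subr_ge0.
    lra.
  apply: le_trans qg _; rewrite lerD2l !indicE !mem_setE/= !in_itv/= x0 (ltW x2).
  have := g0 x; have [xk|kx] := leP x (2 * k); first by case: (2 - k <= x) => /=; lra.
  have [kx2|x2k] := leP (2 - k) x; first by rewrite /=; lra.
  by rewrite /g plateau1 //=; lra.
have [x0|x0] := leP x 0.
  have -> : g x = 0 by apply: gs; rewrite negb_and -ltNge (le_lt_trans x0).
  by rewrite mulr0 add0r addr_ge0.
have x2' : 2 <= x by move: x2; rewrite in_itv/= x0/= ltNge => /negbFE.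
have -> : g x = 0; last by rewrite mulr0 add0r addr_ge0.
by rewrite /g /plateau !stept1 ?subrr//; have := k1; lra.
Qed.

End window.

(** The windowed integral of H is 2 [min_mass] minus the windowed integral of V; the latter does not
    depend on time and cancels between s and t. *)
Lemma min_mass_step (T : R) : exists2 C, 0 <= C & forall k s t,
  0 < k -> 2 * k <= 1 -> 0 <= s -> s <= t -> t < T ->
  min_mass k s <= min_mass k t + C * T * k.
Proof.
have [T0|T0] := leP T 0.
  by exists 0 => // k s t _ _ s0 st tT; exfalso; lra.
have [C C0 HC] := min_evolution S (sol T0) pos.
exists C => // k s t k0 k1 s0 st tT.
pose H (t x : R) := n t x - `|n t x - V x|.
pose g := plateau S k (2 - k) k.
have kk : k <= 2 - k by lra.
have HE u x : H u x * g x = 2 * (Num.min (n u x) (V x) * g x) - V x * g x.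
  by rewrite minr_absE /H; field.
have iV := V_g_integrable k0 k1.
have iM u : 0 <= u -> _ := @min_g_integrable k k0 k1 u.
have iH u : 0 <= u -> (leb R).-integrable half (fun x => (H u x * g x)%:E).
  move=> u0; apply: eq_integrable (integrableB _ (integrableZl _ 2 (iM u u0)) iV) => //.
  by move=> x _ /=; rewrite HE -EFinM -EFinB.
have mE u : 0 <= u -> \int[leb R]_(x in `]0, +oo[) (H u x * g x) =
    2 * min_mass k u - \int[leb R]_(x in `]0, +oo[) (V x * g x).
  move=> u0; transitivity (\int[leb R]_(x in `]0, +oo[)
      (2 * (Num.min (n u x) (V x) * g x) - V x * g x)).
    by apply: eq_Rintegral => x _; exact: HE.
  rewrite RintegralB//; last exact: (integrableZl _ 2 (iM u u0)).
  by rewrite RintegralZl//; exact: iM.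
have lip a b x : `|H a x - H b x| <= 2 * `|n a x - n b x|.
  rewrite /H (_ : _ - _ = (n a x - n b x) - (`|n a x - V x| - `|n b x - V x|)); last ring.
  apply: le_trans (ler_normB _ _) _.
  have := ler_dist_dist (n a x - V x) (n b x - V x).
  by rewrite (_ : _ - _ - _ = n a x - n b x); [lra|ring].
have g01 x : 0 <= g x <= 1 by rewrite plateau_ge0// plateau_le1.
have hL a b e : 0 < a -> a <= b -> 0 < e -> b + e < T -> _ := @HC k a b e k0 k1.
have := @evolution_le _ S H g T (C * T * k) iH
  (slice_continuous iN (cN T0) lip g01 iH) hL s t s0 st tT.
rewrite !mE//; last exact: le_trans st.
have : 0 <= C * T * k by rewrite !mulr_ge0// ltW.
by lra.
Qed.

Let nhat_half : (leb R).-integrable half (fun x => (nhat alpha x)%:E).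
Proof. exact: integrableS measurableT _ _ (nhat_integrable alpha0). Qed.

Let dist_half t : 0 <= t ->
  (leb R).-integrable half (fun x => (n t x - nhat alpha x)%:E).
Proof. by move=> t0; apply: eq_integrable (integrableB _ (iN t0) nhat_half). Qed.

Lemma limit_small (e : R) : 0 < e -> exists t0, forall t, 0 <= t -> t0 < t ->
  \int[leb R]_(x in `]0, +oo[) `|n t x - nhat alpha x| <= e.
Proof.
move=> e0; have e0' : (0 < e%:E)%E by rewrite lte_fin.
have [t0 [_ Ht0]] := lim (open_ereal_lt' e0'); exists t0 => t tge0 /Ht0 /= h.
rewrite /Rintegral -lee_fin fineK.
  rewrite integral_itv_obnd_cbnd; first exact: ltW.
  by have /measurable_int := integrable_norm (dist_half tge0).
exact: integrable_fin_num (integrable_norm (dist_half tge0)).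
Qed.

(** Monotonicity up to O(k) carries the minimum from s to a late time t, where [min_mass_le_limit]
    compares it with the limit profile. *)
Lemma minimum_le_limit s : 0 <= s ->
  \int[leb R]_(x in (`]0%R, 2%R[%classic : set (measurableTypeR R)))
    Num.min (n s x) (nhat 0 x) <= \int[leb R]_(x in `]0, +oo[) nhat alpha x.
Proof.
move=> s0; apply/ler_addgt0Pr => e e0.
have e20 : 0 < e / 2 by rewrite divr_gt0.
have [t0 Ht0] := limit_small e20; pose t := Num.max s t0 + 1.
have st : s <= t by rewrite /t ler_wpDr// le_max lexx.
have tt0 : t0 < t by rewrite /t ltr_pwDr// le_max lexx orbT.
have {}Ht0 := Ht0 t (le_trans s0 st) tt0.
have [C C0 HC] := min_mass_step (t + 1).
have t10 : 0 <= t + 1 by rewrite addr_ge0// (le_trans s0).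
have K0 : 0 < 2 * (C * (t + 1) + 3) by rewrite mulr_gt0// ltr_wpDl// mulr_ge0.
(* Chosen after t, since the loss C (t + 1) k grows with the time span. Together with the 3k from
   the edges of the window it uses half of e; the distance to the limit uses the other half. *)
pose k := Num.min (1 / 2) (e / (2 * (C * (t + 1) + 3))).
have k0 : 0 < k by rewrite lt_min !divr_gt0.
have k1 : 2 * k <= 1 by rewrite mulrC -ler_pdivlMr// ge_min lexx.
have ke : k * (2 * (C * (t + 1) + 3)) <= e.
  by rewrite -ler_pdivlMr// ge_min lexx orbT.
have h1 := minimum_le_min_mass k0 k1 s0.
have h2 := HC k s t k0 k1 s0 st ltac:(lra).
have h3 := min_mass_le_limit k0 k1 (le_trans s0 st).
by lra.
Qed.

(** * A limit profile without mass forces zero initial data *)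

Section no_limit_mass.
Hypothesis nhat_null : \int[leb R]_(x in `]0, +oo[) nhat alpha x <= 0.

(** By [minimum_le_limit] the minimum of n and [nhat 0] is null on (0, 2); as the profile is
    positive there, n must be the one that vanishes. *)
Lemma vanish_left t : 0 <= t -> {ae leb R, forall x, 0 < x < 2 -> n t x = 0}.
Proof.
move=> t0; have := @Rintegral_le0_ae _ `]0, 2[%classic _ (measurable_itv _)
  (minimum_integrable t0).
have m0 : {ae leb R, forall x, `]0, 2[%classic x ->
    0 <= Num.min (n t x) (nhat 0 x)}.
  apply: ae_lebS (pos t0) => x nx; rewrite /= in_itv/= => /andP[x0 _].
  by rewrite le_min nx// nhat_ge0.
move=> /(_ m0 (le_trans (minimum_le_limit t0) nhat_null)).
apply: ae_lebS => x /= + x02; rewrite in_itv/= => /(_ x02).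
rewrite /nhat x02 /Num.min; case: ifP => // _; case/andP: x02 => x0 x2.
have : 0 < x * (2 - x) by rewrite mulr_gt0 ?subr_gt0.
by rewrite expr2; lra.
Qed.

(** The mass seen through the window does not decrease in time, yet it is bounded by the distance of
    n to [nhat alpha], which tends to 0; so it is already 0 at time 0. *)
Lemma vanish_window (r : R) : 2 <= r ->
  {ae leb R, forall x, 2 <= x <= r -> n 0 x = 0}.
Proof.
move=> r2; pose g := plateau S 1 r 1.
have r1 : 1 <= r by lra.
have g01 x : 0 <= g x <= 1 by rewrite plateau_ge0// plateau_le1.
have mg : measurable_fun half g.
  apply: measurable_funTS; apply: continuous_measurable_fun.
  by apply: smooth_continuous; exact: smooth_plateau.
have iH t : 0 <= t -> (leb R).-integrable half (fun x => (n t x * g x)%:E).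
  move=> t0; apply: le_integrable (iN t0) => //.
    by apply/measurable_EFinP; apply: measurable_funM => //; exact: mN.
  move=> x _; rewrite /= lee_fin normrM -[leRHS]mulr1 ler_wpM2l//.
  by have /andP[g0 g1] := g01 x; rewrite ger0_norm.
have lip a b x : `|n a x - n b x| <= 2 * `|n a x - n b x|.
  by rewrite ler_peMl// ler1n.
have step t : 0 <= t -> \int[leb R]_(x in `]0, +oo[) (n 0 x * g x) <=
    \int[leb R]_(x in `]0, +oo[) (n t x * g x).
  move=> t0; have T0 : 0 < t + 1 by lra.
  have hL a b e : 0 < a -> a <= b -> 0 < e -> b + e < t + 1 -> _ :=
    @mass_evolution _ S _ _ (sol T0) pos r a b e vanish_left r2.
  have := @evolution_le _ S n g (t + 1) 0 iH
    (slice_continuous iN (cN T0) lip g01 iH) hL 0 t (lexx 0) t0 ltac:(lra).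
  by rewrite addr0.
have total t : 0 <= t -> \int[leb R]_(x in `]0, +oo[) (n t x * g x) <=
    \int[leb R]_(x in `]0, +oo[) `|n t x - nhat alpha x|.
  move=> t0; have id := integrable_norm (dist_half t0).
  apply: (@le_trans _ _ (\int[leb R]_(x in `]0, +oo[)
      (nhat alpha x + `|n t x - nhat alpha x|))).
    apply: le_Rintegral => //; first exact: iH.
      by apply: eq_integrable (integrableD _ nhat_half id).
    move=> x _; have h0 := nhat_ge0 x alpha0; have /andP[g0 g1] := g01 x.
    have d0 := ler_norm (n t x - nhat alpha x).
    have r0 : 0 <= nhat alpha x + `|n t x - nhat alpha x| by exact: addr_ge0.
    apply: (@le_trans _ _ ((nhat alpha x + `|n t x - nhat alpha x|) * g x)).
      by apply: ler_wpM2r => //; lra.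
    by rewrite -[leRHS]mulr1 ler_wpM2l.
  by rewrite RintegralD// gerDr.
have I0 : \int[leb R]_(x in `]0, +oo[) (n 0 x * g x) <= 0.
  apply/ler_addgt0Pr => e /limit_small[t0 Ht0].
  pose t := Num.max 0 t0 + 1.
  have tge0 : 0 <= t by rewrite /t ler_wpDr// le_max lexx.
  have tt0 : t0 < t by rewrite /t ltr_pwDr// le_max lexx orbT.
  rewrite add0r; apply: le_trans (step t tge0) _.
  exact: le_trans (total t tge0) (Ht0 t tge0 tt0).
have n0g : {ae leb R, forall x, `]0, +oo[%classic x -> 0 <= n 0 x * g x}.
  apply: ae_lebS (pos (lexx 0)) => x nx; rewrite /= in_itv/= andbT => /nx h.
  by have /andP[g0 _] := g01 x; exact: mulr_ge0.
have := Rintegral_le0_ae (measurable_itv _) (iH 0 (lexx 0)) n0g I0.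
apply: ae_lebS => x /= + x2r; rewrite in_itv/= andbT.
have x0 : 0 < x by case/andP: x2r => x2 _; lra.
by move=> /(_ x0); rewrite /g plateau1// mulr1.
Qed.

Lemma vanish_initially : {ae leb R, forall x, 0 < x -> n 0 x = 0}.
Proof.
(* Countably many windows [2, j + 2] exhaust the half-line, so their exceptional sets still form a
   null set. *)
have A : {ae leb R, forall x, forall j : nat, 2 <= x <= j.+2%:R -> n 0 x = 0}.
  by apply/ae_foralln => j; apply: vanish_window; rewrite ler_nat.
apply: ae_lebS2 (vanish_left (lexx 0)) A => x h1 h2 x0.
have [x2|x2] := ltP x 2; first by apply: h1; rewrite x0.
apply: (h2 (Num.bound x)); rewrite x2/=.
apply: le_trans (ltW (archi_boundP (ltW x0))) _.
by rewrite ler_nat; apply: leqW; apply: leqnSn.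
Qed.

End no_limit_mass.
End longtime.

Lemma smooth_step_inhabited (R : realType) : inhabited (smooth_step R).
Proof.
have [S [h1 h2 h3 h4]] := exists_smooth_step (R := R).
exact: (inhabits (SmoothStep h1 h2 h3 h4)).
Qed.

Theorem corollary1p4 (R : realType) (n : R -> R -> R) (n0 : R -> R)
    (alpha : R)
    (hsol : entropy_solution n)
    (hpos : forall t, 0 <= t -> {ae leb R, forall x, 0 < x -> 0 <= n t x})
    (hn0 : (leb R).-integrable `[0, +oo[ (fun x => (n0 x)%:E))
    (hsupp : compactly_supported n0)
    (hinit : initial_data n n0)
    (halpha : 0 <= alpha <= 2)
    (hlim : (\int[leb R]_(x in `[0%R, +oo[) `|n t x - nhat alpha x|%:E)%E
              @[t --> +oo] --> 0%E) :
  (ereal_sup [set \int[leb R]_(x in `[0%R, 2%R])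
                    (Num.min (n t x) (nhat 0 x))%:E | t in `[0%R, +oo[]
     <= total_number (nhat alpha))%E
  /\ (~ ae_zero n0 -> ~ ae_zero (nhat alpha)).
Proof.
have [S] := smooth_step_inhabited R.
have [iN cN n00] := hinit; have /andP[alpha0 _] := halpha.
have ih : (leb R).-integrable (`]0%R, +oo[%classic : set (measurableTypeR R))
    (fun x => (nhat alpha x)%:E).
  exact: integrableS measurableT _ _ (nhat_integrable alpha0).
have totalE : total_number (nhat alpha) =
    (\int[leb R]_(x in `]0, +oo[) nhat alpha x)%:E.
  rewrite /total_number -integral_itv_obnd_cbnd; last exact: measurable_int ih.
  by rewrite fineK//; exact: integrable_fin_num ih.
split.
  apply: ge_ereal_sup => _ [t + <-]; rewrite /= in_itv/= andbT => t0.
  have im := minimum_integrable iN t0.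
  rewrite (@integral_itv_bndoo _ 0 2 _ true false); last exact: measurable_int im.
  rewrite totalE -(fineK (integrable_fin_num _ im))// lee_fin.
  exact: (minimum_le_limit S hsol hpos iN cN alpha0 hlim t0).
move=> hn hz; apply: hn.
have nhat_null : \int[leb R]_(x in `]0, +oo[) nhat alpha x <= 0.
  rewrite /Rintegral (@ae_eq_integral _ _ _ (leb R) _ (cst 0%E))//.
  - by rewrite integral0.
  - exact: measurable_int ih.
  apply: ae_lebS hz => x hx; rewrite /= in_itv/= andbT => x0.
  by rewrite hx// ltW.
(* The initial condition concerns x > 0, whereas [ae_zero] includes x = 0; the point 0 is discarded
   as a null set. *)
have n1 : {ae leb R, forall x : R, x <> 0}.
  exists [set 0]; split; [exact: measurable_set1|exact: lebesgue_measure_set1|].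
  by move=> x /= /contrapT.
have n2 : {ae leb R, forall x, 0 < x -> n0 x = 0}.
  apply: ae_lebS2 (vanish_initially S hsol hpos iN cN alpha0 hlim nhat_null) n00.
  by move=> x nx nn0 x0; rewrite -nn0// nx.
apply: ae_lebS2 n1 n2 => x /eqP x0 nx xge0.
by apply: nx; rewrite lt_neqAle eq_sym x0.
Qed.
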